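(* Let $d,n\in\mathbb{N}$ and $\mu\in\mathcal{M}$, and let $p_n=F_n*\mu$. Then the measure with density $p_n$ converges weakly to $\mu$ as $n\to\infty$, with $$W_1(p_n,\mu)\le\frac{d}{\pi^2}\,\frac{\log(n+1)+3}{n}\cdot\|\mu\|_{\mathrm{TV}}.$$ This is sharp in the sense that every $\mu\in\mathcal{M}_+$ satisfies $\|\mu\|_{\mathrm{TV}}=1$, and $$\sup_{\mu\in\mathcal{M}}W_1(p_n,\mu)\ge\frac{d}{\pi^2}\left(\frac{\log(n+2)}{n+1}+\frac{1}{n+3}\right).$$
   Context: $\mathbb{N}=\{1,2,\dots\}$, $\mathbb{T}^d=[0,1)^d$ is the torus with wrap-around distance $|x-y|_1=\min_{k\in\mathbb{Z}^d}\|x-y+k\|_1$. $\mathcal{M}$ is the set of complex Borel measures $\mu$ on $\mathbb{T}^d$ of finite total variation $\|\mu\|_{\mathrm{TV}}$ with $\mu(\mathbb{T}^d)=1$; $\mathcal{M}_+$ is the subset of non-negative ones. The Fejér kernel is $F_n(x)=\sum_{k=-n}^n\left(1-\frac{|k|}{n+1}\right)e^{2\pi i kx}$ for $x\in\mathbb{T}$ and $F_n(x_1,\dots,x_d)=F_n(x_1)\cdots F_n(x_d)$ on $\mathbb{T}^d$; $p_n(x)=(F_n*\mu)(x)=\int_{\mathbb{T}^d}F_n(x-y)\,\mathrm{d}\mu(y)$. For $f:\mathbb{T}^d\to\mathbb{R}$, $\operatorname{Lip}(f)\le 1$ means $|f(x)-f(y)|\le|x-y|_1$ for all $x,y$. $W_1(\nu,\mu)=\sup_{\operatorname{Lip}(f)\le1}\left|\int_{\mathbb{T}^d}f\,\mathrm{d}(\nu-\mu)\right|$,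 and $W_1(p,\mu)$ means $W_1(\nu,\mu)$ with $\mathrm{d}\nu(x)=p(x)\,\mathrm{d}x$. Weak convergence of $p_n$ to $\mu$ means $\lim_{n\to\infty}\int_{\mathbb{T}^d}f(x)p_n(x)\,\mathrm{d}x=\int_{\mathbb{T}^d}f\,\mathrm{d}\mu$ for all continuous $f:\mathbb{T}^d\to\mathbb{C}$. *)

(* Defs.v *)
From HB Require Import structures.
From mathcomp Require Import all_boot all_order all_algebra.
From mathcomp Require Import complex.
From mathcomp Require Import all_classical all_reals all_analysis.
From mathcomp Require Import measurable_realfun.

Set Implicit Arguments.
Unset Strict Implicit.
Unset Printing Implicit Defensive.

Import Order.TTheory GRing.Theory Num.Theory.
Import numFieldNormedType.Exports.

Local Open Scope classical_set_scope.
Local Open Scope ring_scope.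
Local Open Scope complex_scope.

Notation cmod := ComplexField.Normc.normc.

Section complex_measure.
Context d (T : measurableType d) (R : realType).

(* A complex measure is given by its real and imaginary parts. A [charge] is
   sigma-additive and finite on measurable sets, so such a pair is exactly a
   sigma-additive set function with values in R[i]. *)
Record cmeasure := CMeasure {
  cmeas_re : {charge set T -> \bar R} ;
  cmeas_im : {charge set T -> \bar R} }.

Definition cmeas (mu : cmeasure) (A : set T) : R[i] :=
  fine (cmeas_re mu A) +i* fine (cmeas_im mu A).

Definition csub (nu mu : cmeasure) : cmeasure :=
  CMeasure (cadd (cmeas_re nu) (copp (cmeas_re mu)))
           (cadd (cmeas_im nu) (copp (cmeas_im mu))).

(* The supremum over the countable measurable partitions of the space; since
   blocks may be empty, the finite partitions are included. *)
Definition cmeas_variation (mu : cmeasure) : \bar R :=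
  ereal_sup [set (\sum_(0 <= j <oo) (cmod (cmeas mu (A j)))%:E)%E |
    A in [set A : (set T)^nat | [/\ (forall j, measurable (A j)),
      trivIset [set: nat] A & \bigcup_j A j = [set: T]]]].

Section charge_integral.
Variable nu : {charge set T -> \bar R}.

(* The integral with respect to a signed measure goes through its Jordan
   decomposition, which does not depend on the chosen Hahn decomposition. *)
Definition hahn_pos : set T := projT1 (cid (Hahn_decomposition nu)).

Definition hahn_neg : set T :=
  projT1 (cid (projT2 (cid (Hahn_decomposition nu)))).

Lemma hahn_posneg : hahn_decomposition nu hahn_pos hahn_neg.
Proof. exact: projT2 (cid (projT2 (cid (Hahn_decomposition nu)))). Qed.

Definition charge_integral (f : T -> R) : R :=
  \int[jordan_pos hahn_posneg]_x f x - \int[jordan_neg hahn_posneg]_x f x.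

End charge_integral.

Definition cintegral (mu : cmeasure) (f : T -> R[i]) : R[i] :=
  (charge_integral (cmeas_re mu) (fun x => complex.Re (f x))
     - charge_integral (cmeas_im mu) (fun x => complex.Im (f x)))
  +i* (charge_integral (cmeas_re mu) (fun x => complex.Im (f x))
     + charge_integral (cmeas_im mu) (fun x => complex.Re (f x))).

Section density.
Variable m : {measure set T -> \bar R}.

Definition cLintegral (f : T -> R[i]) : R[i] :=
  (\int[m]_x complex.Re (f x)) +i* (\int[m]_x complex.Im (f x)).

Definition cintegrable (f : T -> R[i]) : Prop :=
  m.-integrable [set: T] (EFin \o (fun x => complex.Re (f x))) /\
  m.-integrable [set: T] (EFin \o (fun x => complex.Im (f x))).

Definition cdensity (f : T -> R[i]) (intf : cintegrable f) : cmeasure :=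
  CMeasure (induced_charge intf.1) (induced_charge intf.2).

End density.

End complex_measure.

Section circle.
Variable R : realType.

Definition circle : Type := {x : R | 0 <= x < 1}.

HB.instance Definition _ := Choice.on circle.

Definition circle0 : circle := exist _ 0 (introT andP (conj (lexx 0) ltr01)).

HB.instance Definition _ := isPointed.Build circle circle0.

Definition circle_val (x : circle) : measurableTypeR R := val x.

(* The trace on [0, 1) of the Borel sets of R; it coincides with the Borel
   sets of the wrap-around topology. *)
HB.instance Definition _ :=
  Measurable.copy circle (g_sigma_algebra_preimageType circle_val).

Lemma measurable_circle_val : measurable_fun [set: circle] circle_val.
Proof. by move=> _ B mB; exists B. Qed.

Let u01 : set (measurableTypeR R) := `[0, 1[%classic.

Let circle_image (B : set (measurableTypeR R)) :
  circle_val @` (circle_val @^-1` B) = B `&` u01.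
Proof.
apply/seteqP; split=> [_ [x Bx <-]|x [Bx]].
  by split=> //; rewrite /u01 /= in_itv/=; exact: (valP x).
rewrite /u01 /= in_itv/= => x01.
by exists (exist _ x x01).
Qed.

Lemma measurable_circle_image (A : set circle) :
  measurable A -> measurable (circle_val @` A).
Proof.
move=> [B mB <-]; rewrite setTI circle_image; apply: measurableI => //.
exact: measurable_itv.
Qed.

Lemma circle_val_inj : injective circle_val.
Proof. exact: val_inj. Qed.

Definition circle_lebesgue (A : set circle) : \bar R :=
  lebesgue_measure (circle_val @` A).

Let circle_lebesgue0 : circle_lebesgue set0 = 0%E.
Proof. by rewrite /circle_lebesgue image_set0 measure0. Qed.

Let circle_lebesgue_ge0 A : (0 <= circle_lebesgue A)%E.
Proof. exact: measure_ge0. Qed.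

Let circle_lebesgue_sigma_additive : semi_sigma_additive circle_lebesgue.
Proof.
move=> F mF tF mUF; rewrite /circle_lebesgue image_bigcup.
apply: measure_semi_sigma_additive.
- by move=> i; exact: measurable_circle_image.
- move=> i j Di Dj [_ [[x Fix <-] [y Fjy /circle_val_inj yx]]].
  by apply: tF => //; exists x; split=> //; rewrite -yx.
- by rewrite -image_bigcup; exact: measurable_circle_image.
Qed.

HB.instance Definition _ := isMeasure.Build _ _ _ circle_lebesgue
  circle_lebesgue0 circle_lebesgue_ge0 circle_lebesgue_sigma_additive.

Let circle_lebesgueT : circle_lebesgue [set: circle] = 1%E.
Proof.
rewrite /circle_lebesgue -(preimage_setT circle_val) circle_image setTI.
by rewrite /u01 lebesgue_measure_itv/= lte01 sube0.
Qed.

HB.instance Definition _ := Measure_isProbability.Build _ _ _ circle_lebesgue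
  circle_lebesgueT.

End circle.

Section torus.
Variable R : realType.

(* Tuples carry the product sigma-algebra, which here is the Borel
   sigma-algebra of the torus. *)
Definition torus (d : nat) : Type := d.-tuple (circle R).

HB.instance Definition _ d := Measurable.on (torus d).

Definition torus_coord d (x : torus d) (i : 'I_d) : R := val (tnth x i).

Definition torus_cons d (p : circle R * torus d) : torus d.+1 :=
  [the d.+1.-tuple (circle R) of p.1 :: p.2].

Lemma measurable_torus_cons d :
  measurable_fun [set: circle R * torus d] (@torus_cons d).
Proof. exact: measurable_cons. Qed.

HB.instance Definition _ d := @isMeasurableFun.Build _ _ _ _
  (@torus_cons d) (@measurable_torus_cons d).

Fixpoint torus_lebesgue d : probability (torus d) R :=
  match d with
  | 0 => [the probability (torus 0) R of dirac ([tuple] : torus 0)]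
  | d'.+1 => [the probability (torus d'.+1) R of
      distribution (@circle_lebesgue R \x torus_lebesgue d')%E (@torus_cons d')]
  end.

End torus.

Section distance.
Variables (R : realType) (d : nat).
Implicit Types x y : torus R d.

Definition torus_dist x y : R :=
  inf [set \sum_(i < d) `|torus_coord x i - torus_coord y i + (k i)%:~R| |
       k in [set: 'I_d -> int]].

Definition torus_lip1 (f : torus R d -> R) : Prop :=
  forall x y, `|f x - f y| <= torus_dist x y.

Definition torus_continuous (f : torus R d -> R[i]) : Prop :=
  forall x (e : R), 0 < e -> exists2 r : R, 0 < r &
    forall y, torus_dist x y < r -> cmod (f x - f y) < e.

Definition W1 (nu mu : cmeasure (torus R d) R) : \bar R :=
  ereal_sup [set (cmod (cintegral (csub nu mu) (fun x => (f x)%:C)))%:E |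
    f in torus_lip1].

Definition normalized_cmeasure : set (cmeasure (torus R d) R) :=
  [set mu | (cmeas_variation mu < +oo)%E /\ cmeas mu [set: torus R d] = 1].

(* The order of R[i] makes [0 <= z] say that [z] is real and nonnegative. *)
Definition nonneg_normalized_cmeasure : set (cmeasure (torus R d) R) :=
  [set mu | normalized_cmeasure mu /\
    forall A, measurable A -> 0 <= cmeas mu A].

End distance.

Section fejer.
Variable R : realType.

Definition expi (t : R) : R[i] := cos t +i* sin t.

(* The index j stands for the frequency k = j - n, so that -n <= k <= n. *)
Definition fejer1 (n : nat) (t : R) : R[i] :=
  \sum_(j < n.*2.+1) let k := (j%:Z - n%:Z)%R in
    (1 - `|k|%:~R / n.+1%:R)%:C * expi (2 * pi * k%:~R * t).

(* [fejer1] is 1-periodic, hence real subtraction of representatives in [0, 1)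
   may be used below for the subtraction of the torus. *)
Definition fejer d (n : nat) (v : 'I_d -> R) : R[i] :=
  \prod_(i < d) fejer1 n (v i).

Definition fejer_conv d (n : nat) (mu : cmeasure (torus R d) R)
    (x : torus R d) : R[i] :=
  cintegral mu (fun y => fejer n (fun i => torus_coord x i - torus_coord y i)).

End fejer.

Section fejer_density.
Variable R : realType.

Let bmeas d (T : measurableType d) (g : T -> R) :=
  measurable_fun [set: T] g /\ exists M : R, forall z, `|g z| <= M.

Let bmeasD d (T : measurableType d) (g h : T -> R) :
  bmeas g -> bmeas h -> bmeas (fun z => g z + h z).
Proof.
move=> [mg [M gM]] [mh [N hN]]; split; first exact: measurable_funD.
by exists (M + N) => z; rewrite (le_trans (ler_normD _ _))// lerD.
Qed.

Let bmeasN d (T : measurableType d) (g : T -> R) :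
  bmeas g -> bmeas (fun z => - g z).
Proof.
move=> [mg [M gM]]; split; first exact: measurableT_comp.
by exists M => z; rewrite normrN.
Qed.

Let bmeasM d (T : measurableType d) (g h : T -> R) :
  bmeas g -> bmeas h -> bmeas (fun z => g z * h z).
Proof.
move=> [mg [M gM]] [mh [N hN]]; split; first exact: measurable_funM.
by exists (M * N) => z; rewrite normrM ler_pM.
Qed.

Let bmeas_cst d (T : measurableType d) (c : R) : bmeas (fun _ : T => c).
Proof. by split => //; exists `|c|. Qed.

Let cbmeas d (T : measurableType d) (g : T -> R[i]) :=
  bmeas (fun z => complex.Re (g z)) /\ bmeas (fun z => complex.Im (g z)).

Let cbmeasD d (T : measurableType d) (g h : T -> R[i]) :
  cbmeas g -> cbmeas h -> cbmeas (fun z => g z + h z).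
Proof.
move=> [g1 g2] [h1 h2]; split.
  under eq_fun do rewrite raddfD; exact: bmeasD.
under eq_fun do rewrite raddfD; exact: bmeasD.
Qed.

Let cbmeasM d (T : measurableType d) (g h : T -> R[i]) :
  cbmeas g -> cbmeas h -> cbmeas (fun z => g z * h z).
Proof.
move=> [g1 g2] [h1 h2]; split.
  rewrite (_ : (fun _ => _) = (fun z => complex.Re (g z) * complex.Re (h z)
      + - (complex.Im (g z) * complex.Im (h z)))).
    by apply: bmeasD; [|apply: bmeasN]; exact: bmeasM.
  by apply/funext => z; case: (g z) (h z) => [a b] [a' b'].
rewrite (_ : (fun _ => _) = (fun z => complex.Re (g z) * complex.Im (h z)
    + complex.Im (g z) * complex.Re (h z))).
  by apply: bmeasD; exact: bmeasM.
by apply/funext => z; case: (g z) (h z) => [a b] [a' b'].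
Qed.

Let cbmeas_cst d (T : measurableType d) (c : R[i]) : cbmeas (fun _ : T => c).
Proof. by split; exact: bmeas_cst. Qed.

Let cbmeas_sum d (T : measurableType d) I (s : seq I) (F : I -> T -> R[i]) :
  (forall i, cbmeas (F i)) -> cbmeas (fun z => \sum_(i <- s) F i z).
Proof.
move=> mF; elim: s => [|i s ih].
  by under eq_fun do rewrite big_nil; exact: cbmeas_cst.
by under eq_fun do rewrite big_cons; exact: cbmeasD.
Qed.

Let cbmeas_prod d (T : measurableType d) I (s : seq I) (F : I -> T -> R[i]) :
  (forall i, cbmeas (F i)) -> cbmeas (fun z => \prod_(i <- s) F i z).
Proof.
move=> mF; elim: s => [|i s ih].
  by under eq_fun do rewrite big_nil; exact: cbmeas_cst.
by under eq_fun do rewrite big_cons; exact: cbmeasM.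
Qed.

Let cbmeas_expi d (T : measurableType d) (g : T -> R) :
  measurable_fun [set: T] g -> cbmeas (fun z => expi (g z)).
Proof.
move=> mg; split; split => /=.
- by apply: measurableT_comp => //; apply: continuous_measurable_fun;
    exact: continuous_cos.
- by exists 1 => z; rewrite ler_norml cos_geN1 cos_le1.
- by apply: measurableT_comp => //; apply: continuous_measurable_fun;
    exact: continuous_sin.
- by exists 1 => z; rewrite ler_norml sin_geN1 sin_le1.
Qed.

Let cbmeas_fejer d n : cbmeas (fun z : torus R d * torus R d =>
  fejer n (fun i => torus_coord z.1 i - torus_coord z.2 i)).
Proof.
rewrite /fejer; apply: cbmeas_prod => i; rewrite /fejer1.
apply: cbmeas_sum => j /=; apply: cbmeasM; first exact: cbmeas_cst.
apply: cbmeas_expi; apply: measurable_funM => //.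
have mc : measurable_fun [set: torus R d]
    (fun x : torus R d => torus_coord x i).
  apply: (@measurableT_comp _ _ _ _ _ _ (@circle_val R)).
    exact: measurable_circle_val.
  exact: measurable_tnth.
apply: measurable_funB.
  exact: (measurableT_comp mc measurable_fst).
exact: (measurableT_comp mc measurable_snd).
Qed.

Let bmeas_integrable d1 d2 (T1 : measurableType d1) (T2 : measurableType d2)
    (m1 : {finite_measure set T1 -> \bar R})
    (m2 : {finite_measure set T2 -> \bar R}) (h : T1 * T2 -> R) :
  bmeas h ->
  m1.-integrable [set: T1] (EFin \o (fun x => \int[m2]_y h (x, y))).
Proof.
move=> [mh [M hM]].
have bh d (T : measurableType d) (g : T -> T1 * T2) :
    [bounded h (g y) | y in [set: T]].
  exists M; split; first exact: num_real.
  by move=> N MN y _ /=; rewrite (le_trans (hM _))// ltW.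
have ihx x : m2.-integrable [set: T2] (EFin \o (fun y => h (x, y))).
  apply: measurable_bounded_integrable => //; first exact: fin_num_fun_lty.
  exact: measurableT_comp.
have ih : (m1 \x m2)%E.-integrable [set: T1 * T2] (EFin \o h).
  apply: measurable_bounded_integrable => //.
    have m12T : (m1 \x m2)%E [set: T1 * T2] = (m1 [set: T1] * m2 [set: T2])%E.
      by rewrite -product_measure1E// setXTT.
    rewrite /= m12T lte_mul_pinfty//.
      by rewrite ge0_fin_numE// fin_num_fun_lty.
    exact: fin_num_fun_lty.
have := integrable_fubini_F ih; congr integrable.
apply/funext => x /=; rewrite /fubini_F /Rintegral fineK//.
exact: (integrable_fin_num _ (ihx x)).
Qed.

Let charge_integrable d1 d2 (T1 : measurableType d1) (T2 : measurableType d2)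
    (m : {finite_measure set T1 -> \bar R})
    (nu : {charge set T2 -> \bar R}) (h : T1 * T2 -> R) :
  bmeas h ->
  m.-integrable [set: T1]
    (EFin \o (fun x => charge_integral nu (fun y => h (x, y)))).
Proof.
move=> bh; rewrite /charge_integral.
have := integrableB measurableT
  (bmeas_integrable m (jordan_pos (hahn_posneg nu)) bh)
  (bmeas_integrable m (jordan_neg (hahn_posneg nu)) bh).
exact.
Qed.

Lemma fejer_conv_integrable d n (mu : cmeasure (torus R d) R) :
  cintegrable (torus_lebesgue R d) (fejer_conv n mu).
Proof.
have [bre bim] := cbmeas_fejer d n.
split; rewrite /fejer_conv /cintegral /=.
- have := integrableB measurableT
    (charge_integrable (torus_lebesgue R d) (cmeas_re mu) bre)
    (charge_integrable (torus_lebesgue R d) (cmeas_im mu) bim).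
  exact.
- have := integrableD measurableT
    (charge_integrable (torus_lebesgue R d) (cmeas_re mu) bim)
    (charge_integrable (torus_lebesgue R d) (cmeas_im mu) bre).
  exact.
Qed.

Definition fejer_measure d n (mu : cmeasure (torus R d) R) :
  cmeasure (torus R d) R := cdensity (fejer_conv_integrable n mu).

End fejer_density.

(* [p n] stands for the measure with density [p n]. *)
Definition density_weak_cvg (R : realType) d (p : nat -> torus R d -> R[i])
    (mu : cmeasure (torus R d) R) : Prop :=
  forall f : torus R d -> R[i], torus_continuous f ->
    (fun n => cLintegral (torus_lebesgue R d) (fun x => f x * p n x)
       : R[i]^o) @ \oo --> (cintegral mu f : R[i]^o).

(* Main.v *)
(* Every 1-Lipschitz f satisfies |F_n * f - f| <= d * C_n, where C_n is the
   integral of the distance ||t|| to the nearest integer against the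
   one-dimensional Fejer kernel; integrating against mu gives the upper bound,
   and the Dirac mass at y, with f the distance to y, attains d * C_n. Expanding
   the kernel,
     C_n = 1/4 - 2/pi^2 * sum_{k <= n, k odd} (1/k^2 - 1/(k (n+1))),
   so everything reduces to bounding odd harmonic sums and the difference
   pi^2/8 - sum_{k <= n, k odd} 1/k^2. That the latter is a tail of the series
   comes for free: C_n >= 0 by positivity of the kernel, and C_n -> 0 because
   ||t||^2 <= 1 - cos(2 pi t), whose integral against the kernel is 1/(n+1).
   Weak convergence follows from C_n -> 0 and uniform continuity. *)
Require Import Defs.
From HB Require Import structures.
From mathcomp Require Import all_boot all_order all_algebra.
From mathcomp Require Import complex.
From mathcomp Require Import all_classical all_reals all_analysis.
From mathcomp Require Import measurable_realfun.
From mathcomp Require Import ring lra zify.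

Set Implicit Arguments.
Unset Strict Implicit.
Unset Printing Implicit Defensive.

Import Order.TTheory GRing.Theory Num.Theory.
Import numFieldNormedType.Exports.

Local Open Scope classical_set_scope.
Local Open Scope ring_scope.

(** * Bounded measurable functions and integration against charges *)

(** [charge_integral] is built on a chosen Hahn decomposition, which does not behave additively: the
    Jordan parts of a sum or difference of charges are not the sums or differences of the Jordan
    parts. The proof therefore never manipulates decompositions. It fixes the class [bmeas], which
    is stable under algebraic operations and integrable for every finite measure, and relies on one
    uniqueness principle: a functional that is linear on this class and bounded in the sup norm is
    determined by its values on indicators. The convolution is moved from [mu] to the test function
    by Fubini, so that W1 only involves integrals of F_n * f - f against [mu] itself. A sup-norm
    bound then suffices, with constant exactly 1 in front of the total variation. Limits are
    replaced by estimates with a free parameter [e], of the form e + 1/(e(n+1)), which come from the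
    inequality of arithmetic and geometric means and avoid square roots. *)

Definition bmeas (R : realType) d (T : measurableType d) (g : T -> R) :=
  measurable_fun [set: T] g /\ exists M : R, forall z, `|g z| <= M.

Section bounded_measurable.
Context (R : realType) d (T : measurableType d).
Implicit Types g h : T -> R.

Lemma bmeas_cst (c : R) : bmeas (fun _ : T => c).
Proof. by split => //; exists `|c|. Qed.

Lemma bmeasD g h : bmeas g -> bmeas h -> bmeas (fun z => g z + h z).
Proof.
move=> [mg [M gM]] [mh [N hN]]; split; first exact: measurable_funD.
by exists (M + N) => z; rewrite (le_trans (ler_normD _ _))// lerD.
Qed.

Lemma bmeasM g h : bmeas g -> bmeas h -> bmeas (fun z => g z * h z).
Proof.
move=> [mg [M gM]] [mh [N hN]]; split; first exact: measurable_funM.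
by exists (M * N) => z; rewrite normrM ler_pM.
Qed.

Lemma bmeasZ (c : R) g : bmeas g -> bmeas (fun z => c * g z).
Proof. by apply: bmeasM; exact: bmeas_cst. Qed.

Lemma bmeasN g : bmeas g -> bmeas (fun z => - g z).
Proof. by under eq_fun do rewrite -mulN1r; exact: bmeasZ. Qed.

Lemma bmeasB g h : bmeas g -> bmeas h -> bmeas (fun z => g z - h z).
Proof. by move=> bg bh; apply: bmeasD => //; exact: bmeasN. Qed.

Lemma bmeas_sum I (s : seq I) (F : I -> T -> R) :
  (forall i, bmeas (F i)) -> bmeas (fun z => \sum_(i <- s) F i z).
Proof.
move=> mF; elim: s => [|i s ih].
  by under eq_fun do rewrite big_nil; exact: bmeas_cst.
by under eq_fun do rewrite big_cons; exact: bmeasD.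
Qed.

Lemma bmeas_prod I (s : seq I) (F : I -> T -> R) :
  (forall i, bmeas (F i)) -> bmeas (fun z => \prod_(i <- s) F i z).
Proof.
move=> mF; elim: s => [|i s ih].
  by under eq_fun do rewrite big_nil; exact: bmeas_cst.
by under eq_fun do rewrite big_cons; exact: bmeasM.
Qed.

Lemma bmeas_indic (A : set T) : measurable A -> bmeas (\1_A : T -> R).
Proof.
move=> mA; split; first exact: measurable_indic.
by exists 1 => z; rewrite indicE; case: (_ \in _); rewrite ?normr1 ?normr0.
Qed.

End bounded_measurable.

Lemma bmeas_comp (R : realType) d d' (T : measurableType d)
    (T' : measurableType d') (g : T' -> R) (f : T -> T') :
  measurable_fun [set: T] f -> bmeas g -> bmeas (g \o f).
Proof.
move=> mf [mg [M gM]]; split; first exact: measurableT_comp.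
by exists M => z; exact: gM.
Qed.

Section bounded_functional.
Context (R : realType) d (T : measurableType d).
Implicit Types (g h : T -> R) (L : (T -> R) -> R).

(** Linearity is asked on [bmeas] only, since the integral is not linear on arbitrary functions. The
    constant [K] carries no sign condition. *)
Definition bounded_functional L := [/\
  forall g h, bmeas g -> bmeas h -> L (fun x => g x + h x) = L g + L h,
  forall c g, bmeas g -> L (fun x => c * g x) = c * L g &
  exists K, forall g M, bmeas g -> (forall x, `|g x| <= M) -> `|L g| <= K * M].

Section theory.
Variable L : (T -> R) -> R.
Hypothesis bL : bounded_functional L.

Lemma bounded_functional0 : L (fun=> 0) = 0.
Proof.
case: bL => _ LZ _; have := LZ 0 _ (bmeas_cst T 0).
by under eq_fun do rewrite mul0r; rewrite mul0r.
Qed.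

Lemma bounded_functional_sum I (s : seq I) (F : I -> T -> R) :
  (forall i, bmeas (F i)) ->
  L (fun x => \sum_(i <- s) F i x) = \sum_(i <- s) L (F i).
Proof.
case: (bL) => LD _ _ bF; elim: s => [|i s ih].
  by under eq_fun do rewrite big_nil; rewrite big_nil bounded_functional0.
under eq_fun do rewrite big_cons.
by rewrite LD// ?ih ?big_cons//; exact: bmeas_sum.
Qed.

Lemma bounded_functionalB g h : bmeas g -> bmeas h ->
  L (fun x => g x - h x) = L g - L h.
Proof.
case: (bL) => LD LZ _ bg bh; rewrite LD//; last exact: bmeasN.
rewrite -mulN1r -LZ//; congr (_ + L _).
by apply/funext => x; rewrite mulN1r.
Qed.

(* Bounded measurable functions are uniform limits of step functions. *)
Lemma bounded_functional_eq0 g :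
  (forall A, measurable A -> L (\1_A) = 0) -> bmeas g -> L g = 0.
Proof.
move=> L0 bg; case: (bL) => LD LZ [K LK].
have [mg [M gM]] := bg.
have M0 : 0 <= M by exact: le_trans (gM point).
suff H (e : R) : 0 < e -> `|L g| <= K * e.
  apply/eqP; rewrite -normr_le0; apply/ler_addgt0Pl => e e0; rewrite addr0.
  (* Since [K] may be nonpositive, rescaling [e] by [K] is only possible in the second case; in the
     first the bound [K * e] is already at most 0. *)
  have [K0|K0] := leP K 0.
    by rewrite (le_trans (H _ e0))// (le_trans _ (ltW e0))// mulr_le0_ge0// ltW.
  rewrite (le_trans (H (e / K) _)) ?divr_gt0//.
  by rewrite mulrCA divff ?mulr1// gt_eqF.
move=> e0.
(* [h] maps the range [-M, M] of [g] into [0, 2M/e]; its unit level sets cut [g] into slices of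
   height [e], and [N] slices cover the whole range. On each slice [s] takes the lower end. *)
pose h x := (g x + M) / e.
have h0 x : 0 <= h x.
  apply: divr_ge0; last exact: ltW.
  by have := gM x; rewrite ler_norml => /andP[+ _]; rewrite -subr_ge0 opprK.
pose A j := h @^-1` `[j%:R, j.+1%:R[%classic.
have mA j : measurable (A j).
  rewrite -[A j]setTI; apply: measurable_funM; last exact: measurable_itv.
  - by apply: measurable_funD.
  - exact: measurable_cst.
  - exact: measurableT.
pose N := (Num.truncn (2 * M / e)).+1.
pose s x := \sum_(j < N) (e * j%:R - M) * \1_(A j) x.
have bs : bmeas s.
  by apply: bmeas_sum => j; apply: bmeasZ; exact: bmeas_indic.
have Ls : L s = 0.
  rewrite bounded_functional_sum.
    by rewrite big1// => j _; rewrite LZ ?L0 ?mulr0//; exact: bmeas_indic.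
  by move=> j; apply: bmeasZ; exact: bmeas_indic.
have -> : L g = L (fun x => g x - s x) by rewrite bounded_functionalB// Ls
  subr0.
apply: LK; first exact: bmeasB.
move=> x; set j := Num.truncn (h x).
have /andP[jh hj] := truncn_itv (h0 x).
have jN : (j < N)%N.
  rewrite ltnS; apply: le_truncn.
  rewrite ler_pM2r ?invr_gt0// mulr_natl mulr2n lerD2r.
  by rewrite (le_trans (ler_norm _)).
have -> : s x = e * j%:R - M.
  rewrite /s (bigD1 (Ordinal jN))//= big1 ?addr0; last first.
    move=> i /eqP ij; rewrite indicE memNset ?mulr0//.
    rewrite /A /= in_itv/= => /andP[ih hi]; apply: ij; apply/val_inj => /=.
    by apply/esym/truncn_def; rewrite ih hi.
  by rewrite indicE mem_set ?mulr1//= /A/= in_itv/= jh hj.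
have -> : g x = e * h x - M by rewrite /h mulrC divfK ?gt_eqF// addrK.
rewrite (_ : e * h x - M - _ = e * (h x - j%:R)); last by ring.
rewrite normrM gtr0_norm// ger0_norm ?subr_ge0//.
rewrite -[leRHS]mulr1 ler_pM2l// lerBlDr.
by rewrite addrC natr1 ltW.
Qed.

End theory.

Lemma bounded_functionalD L1 L2 :
  bounded_functional L1 -> bounded_functional L2 ->
  bounded_functional (fun g => L1 g + L2 g).
Proof.
move=> [D1 Z1 [K1 LK1]] [D2 Z2 [K2 LK2]]; split.
- by move=> g h bg bh; rewrite D1// D2// addrACA.
- by move=> c g bg; rewrite Z1// Z2// mulrDr.
- exists (K1 + K2) => g M bg gM; rewrite (le_trans (ler_normD _ _))// mulrDl.
  by rewrite lerD// ?LK1// LK2.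
Qed.

Lemma bounded_functionalZ L c :
  bounded_functional L -> bounded_functional (fun g => c * L g).
Proof.
move=> [D Z [K LK]]; split.
- by move=> g h bg bh; rewrite D// mulrDr.
- by move=> k g bg; rewrite Z// mulrCA.
- by exists (`|c| * K) => g M bg gM; rewrite normrM -mulrA ler_wpM2l// LK.
Qed.

Lemma bounded_functional_eq L1 L2 g :
  bounded_functional L1 -> bounded_functional L2 ->
  (forall A, measurable A -> L1 (\1_A) = L2 (\1_A)) ->
  bmeas g -> L1 g = L2 g.
Proof.
move=> b1 b2 L12 bg; apply/eqP; rewrite -subr_eq0 -mulN1r; apply/eqP.
apply: (@bounded_functional_eq0 (fun g => L1 g + -1 * L2 g)) => //.
  by apply: bounded_functionalD => //; exact: bounded_functionalZ.
by move=> A mA; rewrite L12// mulN1r subrr.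
Qed.

End bounded_functional.

Section finite_measure_integral.
Context (R : realType) d (T : measurableType d).
Variable m : {finite_measure set T -> \bar R}.

Lemma bmeas_integrable (g : T -> R) :
  bmeas g -> m.-integrable [set: T] (EFin \o g).
Proof.
move=> [mg [M gM]]; apply: measurable_bounded_integrable => //.
  exact: fin_num_fun_lty.
exists M; split; first exact: num_real.
by move=> N MN y _ /=; rewrite (le_trans (gM _))// ltW.
Qed.

Lemma normr_Rintegral_le (g : T -> R) M :
  bmeas g -> (forall x, `|g x| <= M) -> `|\int[m]_x g x| <= M * fine (m setT).
Proof.
move=> bg gM; rewrite -Rintegral_cst//.
rewrite (le_trans (le_normr_Rintegral _ (bmeas_integrable bg)))//.
apply: le_Rintegral => //; last exact: bmeas_integrable (bmeas_cst _ _).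
apply: bmeas_integrable; case: bg => mg [N gN]; split.
  exact: measurableT_comp.
by exists N => z; rewrite normr_id.
Qed.

Lemma bounded_functional_Rintegral :
  bounded_functional (fun g : T -> R => \int[m]_x g x).
Proof.
split.
- by move=> g h bg bh; rewrite RintegralD//; exact: bmeas_integrable.
- by move=> c g bg; rewrite RintegralZl//; exact: bmeas_integrable.
- exists (fine (m [set: T])) => g M bg gM.
  by rewrite mulrC normr_Rintegral_le.
Qed.

Lemma RintegralE_bmeas (g : T -> R) : bmeas g ->
  (\int[m]_x (g x)%:E = (\int[m]_x g x)%:E)%E.
Proof.
move=> bg; rewrite /Rintegral fineK//.
exact: integrable_fin_num (bmeas_integrable bg).
Qed.

Lemma Rintegral_indicT (A : set T) : measurable A ->
  \int[m]_x (\1_A x : R) = fine (m A).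
Proof. by move=> mA; rewrite /Rintegral integral_indic// setIT. Qed.

End finite_measure_integral.

(** * Calculus of integrals against charges *)

Section charge_integral_theory.
Context (R : realType) d (T : measurableType d).
Implicit Types nu : {charge set T -> \bar R}.

Lemma bounded_functional_charge nu : bounded_functional (charge_integral nu).
Proof.
rewrite /charge_integral; under eq_fun do rewrite -mulN1r.
apply: bounded_functionalD; last apply: bounded_functionalZ;
  exact: bounded_functional_Rintegral.
Qed.

Lemma charge_integral_indic nu (A : set T) : measurable A ->
  charge_integral nu \1_A = fine (nu A).
Proof.
move=> mA; rewrite /charge_integral !Rintegral_indicT//.
rewrite (jordan_decomp (hahn_posneg nu) mA)/= /cadd/= cscaleN1/=.
by rewrite fineB// fin_num_measure.
Qed.

(** Removes the Hahn decomposition from sight: to compute an integral it is enough to guess a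
    bounded functional and check it on measurable sets. Sums, multiples, opposites, densities and
    Dirac masses are all instances. *)
Lemma charge_integralP nu (L : (T -> R) -> R) (g : T -> R) :
  bounded_functional L ->
  (forall A, measurable A -> fine (nu A) = L \1_A) ->
  bmeas g -> charge_integral nu g = L g.
Proof.
move=> bL nuL; apply: bounded_functional_eq => //.
  exact: bounded_functional_charge.
by move=> A mA; rewrite charge_integral_indic ?nuL.
Qed.

Lemma charge_integral_cadd nu1 nu2 (g : T -> R) : bmeas g ->
  charge_integral (cadd nu1 nu2) g = charge_integral nu1 g + charge_integral
    nu2 g.
Proof.
apply: (@charge_integralP _ (fun g => charge_integral nu1 g + charge_integral
  nu2 g)).
  by apply: bounded_functionalD; exact: bounded_functional_charge.
by move=> A mA; rewrite !charge_integral_indic//= /cadd/= fineD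
  ?fin_num_measure.
Qed.

Lemma charge_integral_cscale (c : R) nu (g : T -> R) : bmeas g ->
  charge_integral (cscale c nu) g = c * charge_integral nu g.
Proof.
apply: (@charge_integralP _ (fun g => c * charge_integral nu g)).
  by apply: bounded_functionalZ; exact: bounded_functional_charge.
by move=> A mA; rewrite !charge_integral_indic//= /cscale/= fineM
  ?fin_num_measure.
Qed.

Lemma charge_integral_copp nu (g : T -> R) : bmeas g ->
  charge_integral (copp nu) g = - charge_integral nu g.
Proof.
move=> bg; rewrite -mulN1r.
apply: (@charge_integralP _ (fun g => -1 * charge_integral nu g)) => //.
  by apply: bounded_functionalZ; exact: bounded_functional_charge.
by move=> A mA; rewrite !charge_integral_indic//= /copp/= fineN mulN1r.
Qed.

Lemma charge_integral_induced (m : {finite_measure set T -> \bar R})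
    (p : T -> R) (ip : m.-integrable [set: T] (EFin \o p)) (g : T -> R) :
  bmeas p -> bmeas g ->
  charge_integral (induced_charge ip) g = \int[m]_x (g x * p x).
Proof.
move=> bp; apply: (@charge_integralP _ (fun g => \int[m]_x (g x * p x))).
  have [D Z [K LK]] := bounded_functional_Rintegral m.
  have [_ [N pN]] := bp.
  split.
  - move=> f h bf bh; rewrite -D//; [|exact: bmeasM..].
    by congr Rintegral; apply/funext => x; rewrite mulrDl.
  - move=> c f bf; rewrite -Z//; last exact: bmeasM.
    by congr Rintegral; apply/funext => x; rewrite mulrA.
  - exists (K * N) => f M bf fM.
    rewrite (_ : K * N * M = K * (M * N)); last by rewrite -mulrA (mulrC M).
    by apply: LK; [exact: bmeasM|move=> x; rewrite normrM ler_pM].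
move=> A mA; rewrite /= /induced_charge/= /Rintegral [in LHS]integral_mkcond.
congr fine; apply: eq_integral => x _.
by rewrite patchE indicE; case: (x \in A); rewrite /= ?mul1r ?mul0r.
Qed.

End charge_integral_theory.

(** * Complex measures and their total variation *)

Section complex_measure_theory.
Context (R : realType) d (T : measurableType d).
Implicit Types mu : cmeasure T R.

Lemma cintegral_real mu (g : T -> R) :
  cintegral mu (fun x => (g x)%:C)%C =
  (charge_integral (cmeas_re mu) g +i* charge_integral (cmeas_im mu) g)%C.
Proof.
rewrite /cintegral /= !(bounded_functional0 (bounded_functional_charge _)).
by rewrite subr0 add0r.
Qed.

Lemma cmodE (x y : R) : cmod (x +i* y)%C = Num.sqrt (x ^+ 2 + y ^+ 2).
Proof. by []. Qed.

Lemma cmod_ge0 (z : R[i]) : 0 <= cmod z.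
Proof. by case: z => x y; rewrite cmodE sqrtr_ge0. Qed.

(** Lagrange's identity: the gap between the two squares is (bx - ay)^2. *)
Lemma cauchy_schwarz_cmod (a b x y : R) :
  a ^+ 2 + b ^+ 2 = 1 -> `|a * x + b * y| <= cmod (x +i* y)%C.
Proof.
move=> ab1; rewrite cmodE -sqrtr_sqr ler_wsqrtr//.
rewrite -subr_ge0 (_ : _ - _ = (b * x - a * y) ^+ 2) ?sqr_ge0//.
by rewrite -[X in X - _]mul1r -ab1; ring.
Qed.

(** The unit vector (a, b) is the direction of x + iy, so that multiplication by a - ib rotates this
    number onto the positive real axis. *)
Lemma cmod_polar (x y : R) : exists a b : R,
  a ^+ 2 + b ^+ 2 = 1 /\ cmod (x +i* y)%C = a * x + b * y.
Proof.
rewrite cmodE; set r := Num.sqrt _.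
have r2 : r ^+ 2 = x ^+ 2 + y ^+ 2 by rewrite sqr_sqrtr// addr_ge0// sqr_ge0.
have [r0|r0] := eqVneq r 0.
  exists 1, 0; rewrite expr1n expr0n addr0; split=> //.
  move: r2; rewrite r0 expr0n /= => /esym/eqP.
  by rewrite paddr_eq0 ?sqr_ge0// !sqrf_eq0 => /andP[/eqP-> _]; ring.
exists (x / r), (y / r); split.
  by rewrite !expr_div_n -mulrDl -r2 divff// expf_neq0.
by rewrite !(mulrAC _ r^-1) -!expr2 -mulrDl -r2 expr2 mulfK.
Qed.

(** Two blocks are all that is needed later: the Hahn sets of a rotated charge, or the whole space
    with the empty set. *)
Lemma cmeas_variation_ge2 mu (P N : set T) :
  measurable P -> measurable N -> P `|` N = setT -> P `&` N = set0 ->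
  ((cmod (cmeas mu P) + cmod (cmeas mu N))%:E <= cmeas_variation mu)%E.
Proof.
move=> mP mN PNT PN0.
pose A := fun j : nat => if j is 0 then P else if j is 1 then N else set0.
apply: (@le_trans _ _ (\sum_(0 <= j <oo) (cmod (cmeas mu (A j)))%:E)%E).
  rewrite EFinD; apply: le_trans (nneseries_lim_ge 2 _).
    by rewrite big_nat_recr//= big_nat1.
  by move=> k _ _; rewrite lee_fin cmod_ge0.
apply: ereal_sup_ubound; exists A => //; split.
- by case=> [|[|j]] /=.
- by apply/trivIsetP => -[|[|i]] [|[|j]] //= _ _ _;
    rewrite ?set0I ?setI0// setIC.
- rewrite -PNT; apply/seteqP; split=> [x [[|[|j]] _ //=]|x [Px|Nx]].
  + by left.
  + by right.
  + by exists 0%N.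
  + by exists 1%N.
Qed.

(** [P] and [N] are the Hahn sets, on which the Jordan parts have total masses nu(P) and -nu(N).
    Only what a two-block partition needs is kept in the conclusion. *)
Lemma normr_charge_integral_le (nu : {charge set T -> \bar R}) (g : T -> R) M :
  bmeas g -> (forall x, `|g x| <= M) ->
  exists P N, [/\ measurable P, measurable N, P `|` N = setT, P `&` N = set0 &
    `|charge_integral nu g| <= M * (`|fine (nu P)| + `|fine (nu N)|)].
Proof.
move=> bg gM.
exists (hahn_pos nu), (hahn_neg nu); have [[mP _] [mN _] PNT PN0] :=
  hahn_posneg nu.
split => //; rewrite /charge_integral (le_trans (ler_normB _ _))//.
rewrite mulrDr lerD//.
  apply: le_trans (normr_Rintegral_le _ bg gM) _.
  rewrite ler_wpM2l//; first exact: le_trans (gM point).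
  have posE : jordan_pos (hahn_posneg nu) setT = nu (hahn_pos nu).
    by rewrite jordan_posE cjordan_posE /= /crestr0 mem_set// /crestr/= setTI.
  by have := ler_norm (fine (nu (hahn_pos nu))); rewrite -{1}posE.
apply: le_trans (normr_Rintegral_le _ bg gM) _.
rewrite ler_wpM2l//; first exact: le_trans (gM point).
have negE : jordan_neg (hahn_posneg nu) setT = (- nu (hahn_neg nu))%E.
  by rewrite jordan_negE cjordan_negE /= /crestr0 mem_set// /crestr/= setTI.
by have := ler_norm (- fine (nu (hahn_neg nu))); rewrite normrN -fineN -{1}negE.
Qed.

(* Rotating the integral onto the positive real axis turns it into an integral
   against the real charge [a re + b im], whose Hahn decomposition is a
   two-block partition. *)
Lemma cmod_cintegral_le mu (g : T -> R) M :
  bmeas g -> (forall x, `|g x| <= M) ->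
  ((cmod (cintegral mu (fun x => (g x)%:C)%C))%:E <= M%:E * cmeas_variation
    mu)%E.
Proof.
move=> bg gM; rewrite cintegral_real.
have [a [b [ab1 ->]]] :=
  cmod_polar (charge_integral (cmeas_re mu) g) (charge_integral (cmeas_im mu)
    g).
pose nu : {charge set T -> \bar R} :=
  cadd (cscale a (cmeas_re mu)) (cscale b (cmeas_im mu)).
have nuE A : measurable A -> `|fine (nu A)| <= cmod (cmeas mu A).
  move=> mA; rewrite /nu/= /cadd/= /cscale fineD ?fin_numM ?fin_num_measure//.
  by rewrite !fineM ?fin_num_measure// cauchy_schwarz_cmod.
have M0 : 0 <= M by exact: le_trans (gM point).
rewrite -!charge_integral_cscale// -charge_integral_cadd//.
have [P [N [mP mN PNT PN0 H]]] := normr_charge_integral_le nu bg gM.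
apply: (@le_trans _ _ (M * (cmod (cmeas mu P) + cmod (cmeas mu N)))%:E).
  rewrite lee_fin (le_trans (ler_norm _))// (le_trans H)// ler_wpM2l//.
  by rewrite lerD// nuE.
by rewrite EFinM lee_wpmul2l ?lee_fin// cmeas_variation_ge2.
Qed.

(** For a nonnegative measure the modulus drops out, and sigma-additivity gives every partition the
    same sum, mu(T) = 1. *)
Lemma cmeas_variation_nonneg mu :
  (forall A, measurable A -> 0 <= cmeas mu A) ->
  cmeas mu setT = 1 -> cmeas_variation mu = 1%E.
Proof.
move=> mu0 mu1.
have cmodA A : measurable A -> ((cmod (cmeas mu A))%:E = cmeas_re mu A)%E.
  move=> /[dup] mA /mu0; rewrite /cmeas lecE/= => /andP[/eqP -> re0].
  by rewrite expr0n/= addr0 sqrtr_sqr ger0_norm// fineK// fin_num_measure.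
have re1 : cmeas_re mu setT = 1%E.
  rewrite -cmodA// mu1/=; congr EFin; rewrite expr1n expr0n addr0 sqrtr1//.
have key (A : (set T)^nat) : (forall j, measurable (A j)) ->
    trivIset setT A -> \bigcup_j A j = setT ->
    (\sum_(0 <= j <oo) (cmod (cmeas mu (A j)))%:E = 1)%E.
  move=> mA tA UA; under eq_eseriesr do rewrite cmodA//.
  rewrite -re1 -UA; apply/cvg_lim => //.
  by apply: charge_semi_sigma_additive => //; rewrite UA.
rewrite -[RHS]ereal_sup1 /cmeas_variation; congr ereal_sup.
apply/seteqP; split=> [_ [A [mA tA UA] <-]|_ ->]; first exact: key.
(* The trivial partition shows that the supremum is not over the empty set. *)
pose A := fun j : nat => if j is 0 then [set: T] else set0.
have mA j : measurable (A j) by case: j => /=.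
have tA : trivIset setT A.
  by apply/trivIsetP => -[|i] [|j] //= _ _ _; rewrite ?set0I ?setI0.
have UA : \bigcup_j A j = setT.
  by apply/seteqP; split=> // x _; exists 0%N.
by exists A => //; exact: key.
Qed.

End complex_measure_theory.

(** * The one-dimensional Fejer kernel and its first moment *)

Section nearest_integer_distance.
Variable R : realType.
Implicit Types (s t : R) (k : int).

Definition nid t : R := let u := t - (Num.floor t)%:~R in Num.min u (1 - u).

Lemma nid_int t k : nid (t + k%:~R) = nid t.
Proof.
rewrite /nid floorDrz ?intr_int// intrKfloor.
by rewrite intrD opprD addrACA subrr addr0.
Qed.

Lemma frac_itv t : 0 <= t - (Num.floor t)%:~R < 1.
Proof. by rewrite subr_ge0 floor_le_tmp /= ltrBlDl -intrD1 floorD1_gt. Qed.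

Lemma nid_ge0 t : 0 <= nid t.
Proof. by have /andP[t0 t1] := frac_itv t; rewrite le_min t0 subr_ge0 ltW. Qed.

Lemma nid_le_norm t : nid t <= `|t|.
Proof.
rewrite /nid ge_min; have [t0|t0] := leP 0 t.
  by rewrite ger0_norm// lerBlDr lerDl ler0z floor_ge0 t0.
apply/orP; right; rewrite ltr0_norm//.
have : (Num.floor t + 1)%:~R <= 0%:~R :> R by rewrite ler_int lezD1 floor_lt0.
by rewrite intrD1; lra.
Qed.

Lemma nid_le t k : nid t <= `|t + k%:~R|.
Proof. by rewrite -(nid_int t k) nid_le_norm. Qed.

(** With [nid_le], this makes [nid t] the minimum of |t + k| over the integers k; subadditivity,
    symmetry and the formula for [torus_dist] follow from this description rather than from
    fractional parts. *)
Lemma nid_ex t : exists k, nid t = `|t + k%:~R|.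
Proof.
have /andP[t0 t1] := frac_itv t.
rewrite /nid; case: leP => _.
  by exists (- Num.floor t); rewrite intrN ger0_norm.
exists (- (Num.floor t + 1)); rewrite intrN intrD1 ler0_norm; first by ring.
by move: t1; lra.
Qed.

Lemma nidD s t : nid (s + t) <= nid s + nid t.
Proof.
have [k ->] := nid_ex s; have [l ->] := nid_ex t.
apply: le_trans (nid_le _ (k + l)) _.
by rewrite intrD addrACA ler_normD.
Qed.

Lemma nidN t : nid (- t) = nid t.
Proof.
suff H s : nid (- s) <= nid s by apply/le_anti; rewrite H -{1}[t]opprK H.
have [k ->] := nid_ex s; apply: le_trans (nid_le _ (- k)) _.
by rewrite intrN -opprD normrN.
Qed.

Lemma nid_lip s t : `|nid s - nid t| <= nid (s - t).
Proof.
have := nidD (s - t) t; have := nidD (t - s) s.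
rewrite -(nidN (t - s)) opprB !subrK ler_norml => ? ?.
by apply/andP; split; lra.
Qed.

Lemma continuous_nid : continuous nid.
Proof.
move=> t; apply/cvgrPdist_lt => e e0; near=> s.
apply: le_lt_trans (nid_lip _ _) _; apply: le_lt_trans (nid_le_norm _) _.
by near: s; apply: (@cvgr_dist_lt _ R^o).
Unshelve. all: by end_near. Qed.

Lemma nid_lower t : 0 <= t <= 2^-1 -> nid t = t.
Proof.
move=> /andP[t0 t1]; rewrite /nid (_ : Num.floor t = 0); last first.
  by apply: floor_def; rewrite t0 /=; move: t1; lra.
by rewrite subr0; apply/min_idPl; move: t1; lra.
Qed.

Lemma nid_upper t : 2^-1 <= t <= 1 -> nid t = 1 - t.
Proof.
move=> /andP[t0 t1].
rewrite -(nidN t) -(nid_int (- t) 1) addrC nid_lower//.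
by move: t0 t1; lra.
Qed.

Lemma nid_le1 t : nid t <= 1.
Proof. by rewrite ge_min; have /andP[t0 /ltW->] := frac_itv t. Qed.

End nearest_integer_distance.

Section fejer_kernel.
Variable R : realType.

Definition fejer_coef (n k : nat) : R := 1 - k%:R / n.+1%:R.

Definition fejerR (n : nat) (t : R) : R :=
  1 + 2 * \sum_(1 <= k < n.+1) fejer_coef n k * cos (2 * pi * k%:R * t).

(** Pairs the frequencies k and -k; each step of the induction peels off the two extreme ones. *)
Lemma big_ord_centered (V : zmodType) (G : int -> V) (n : nat) :
  \sum_(j < n.*2.+1) G (j%:Z - n%:Z) =
  G 0 + \sum_(1 <= k < n.+1) (G k%:Z + G (- k%:Z)).
Proof.
elim: n => [|n ih]; first by rewrite big_ord1 big_geq// [RHS]addr0; congr G.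
rewrite doubleS big_ord_recl big_ord_recr /=.
rewrite (eq_bigr (fun j : 'I_n.*2.+1 => G (j%:Z - n%:Z))); last first.
  by move=> j _; congr G; rewrite /bump /=; lia.
rewrite ih [in RHS]big_nat_recr//= sub0r addrA.
rewrite (_ : (bump 0 n.*2.+1)%:Z - n.+1%:Z = n.+1%:Z);
  last by rewrite /bump /=; lia.
by rewrite addrCA -addrA; congr (_ + _); rewrite addrAC addrC; congr (_ + _);
  rewrite addrC.
Qed.

Lemma fejer1E n (t : R) : fejer1 n t = ((fejerR n t)%:C)%C.
Proof.
pose G (k : int) : R[i] := ((1 - `|k|%:~R / n.+1%:R)%:C)%C * expi (2 * pi *
  k%:~R * t).
rewrite /fejer1 (big_ord_centered G).
have -> : G 0 = 1.
  by rewrite /G normr0 mul0r subr0 mulr0 mul0r /expi cos0 sin0 mulr1.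
rewrite /fejerR rmorphD rmorph1 rmorphM rmorph_sum/= mulr_sumr; congr (_ + _).
apply: eq_bigr => k _.
rewrite /G normrN !ger0_norm// -mulrDr /expi intrN mulrN mulNr cosN sinN.
by apply/eqP; rewrite eq_complex/=; apply/andP; split; apply/eqP;
  rewrite /fejer_coef; ring.
Qed.

(* [n+1] times the kernel is the squared modulus of a geometric sum. *)
Lemma fejerR_sumsq n (t : R) : n.+1%:R * fejerR n t =
  (\sum_(k < n.+1) cos (2 * pi * k%:R * t)) ^+ 2 +
  (\sum_(k < n.+1) sin (2 * pi * k%:R * t)) ^+ 2.
Proof.
have E m : m.+1%:R * fejerR m t =
    m.+1%:R + 2 * \sum_(1 <= k < m.+1) (m.+1%:R - k%:R) * cos (2 * pi * k%:R *
      t).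
  rewrite /fejerR mulrDr mulr1 mulrCA; congr (_ + 2 * _); rewrite mulr_sumr.
  apply: eq_bigr => k _; rewrite mulrA /fejer_coef; congr (_ * _).
  by rewrite mulrBr mulr1 mulrCA divff ?mulr1// pnatr_eq0.
elim: n => [|n ih].
  by rewrite E big_geq// !big_ord1 !mulr0 mul0r cos0 sin0; ring.
rewrite big_ord_recr/= [X in _ = _ + X ^+ 2]big_ord_recr/=.
set C := \sum_(_ < _) _; set S := \sum_(_ < _) _.
set c := cos _; set s := sin _.
have cs : c ^+ 2 + s ^+ 2 = 1 by exact: cos2Dsin2.
have -> : (C + c) ^+ 2 + (S + s) ^+ 2 =
    (C ^+ 2 + S ^+ 2) + 2 * (C * c + S * s) + 1 by rewrite -[X in _ = _ + X]cs;
      ring.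
rewrite -ih !E.
(* The cross terms are cosines of the frequency differences n+1-k, which run through 1, ..., n+1
   once the sum is reversed. *)
have -> : C * c + S * s = \sum_(1 <= k < n.+2) cos (2 * pi * k%:R * t).
  rewrite !mulr_suml -big_split/= [RHS]big_nat_rev/= big_add1/= big_mkord.
  apply: eq_bigr => k _; rewrite -cosB -cosN opprB; congr cos.
  rewrite (_ : (1 + n.+2 - k.+2)%N = (n.+1 - k)%N); last by lia.
  by rewrite natrB ?(ltnW (ltn_ord k))//; ring.
set D := \sum_(_ <= _ < _) cos _; set B := \sum_(_ <= _ < n.+1) _.
(* From n to n+1 every triangular weight grows by one, which contributes exactly [D]; the new
   frequency n+1 has weight 0 in [B]. *)
suff -> : \sum_(1 <= k < n.+2) (n.+2%:R - k%:R) * cos (2 * pi * k%:R * t) = B +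
  D.
  by rewrite -[n.+2%:R]natr1; ring.
have -> : B = \sum_(1 <= k < n.+2) (n.+1%:R - k%:R) * cos (2 * pi * k%:R * t).
  by rewrite [RHS]big_nat_recr//= subrr mul0r addr0.
by rewrite -big_split/=; apply: eq_bigr => k _; rewrite -[n.+2%:R]natr1; ring.
Qed.

Lemma fejerR_ge0 n (t : R) : 0 <= fejerR n t.
Proof.
rewrite -(pmulr_rge0 _ (ltr0Sn R n)) fejerR_sumsq.
by rewrite addr_ge0// sqr_ge0.
Qed.

End fejer_kernel.

(** * Integrals over the circle as integrals over [0, 1] *)

Section circle_integral.
Variable R : realType.
Notation mu := (@lebesgue_measure R).

Lemma integrable_bmeas_itv (a b : R) (h : R -> R) :
  @bmeas R _ (measurableTypeR R) h -> mu.-integrable `[a, b] (EFin \o h).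
Proof.
move=> [mh [M hM]]; apply: measurable_bounded_integrable => //.
- by rewrite /= lebesgue_measure_itv/=; case: ifP => // _; rewrite -EFinB ltry.
- exact: measurable_funTS.
- exists M; split; first exact: num_real.
  by move=> N MN y _ /=; rewrite (le_trans (hM _))// ltW.
Qed.

Lemma bounded_functional_itv01 :
  @bounded_functional R _ (measurableTypeR R)
    (fun h => \int[mu]_(x in `[0, 1]) h x).
Proof.
split.
- by move=> g h bg bh; rewrite RintegralD//; exact: integrable_bmeas_itv.
- by move=> c g bg; rewrite RintegralZl//; exact: integrable_bmeas_itv.
- exists 1 => g M bg gM; have ig := integrable_bmeas_itv 0 1 bg.
  rewrite (le_trans (le_normr_Rintegral _ ig))//.
  rewrite mul1r (_ : M = \int[mu]_(x in `[0%R, 1%R]) M); last first.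
    by rewrite Rintegral_cst//= lebesgue_measure_itv/= lte_fin ltr01 oppr0
      adde0 mulr1.
  apply: le_Rintegral => //; apply: integrable_bmeas_itv; last exact: bmeas_cst.
  case: bg => mg [N gN]; split; first exact: measurableT_comp.
  by exists N => z; rewrite normr_id.
Qed.

(** Brings integrals to a closed interval, where the fundamental theorem of calculus applies. *)
Lemma circle_Rintegral (h : R -> R) : @bmeas R _ (measurableTypeR R) h ->
  \int[@circle_lebesgue R]_x h (circle_val x) = \int[mu]_(x in `[0, 1]) h x.
Proof.
apply: (@bounded_functional_eq _ _ (measurableTypeR R)
  (fun h => \int[@circle_lebesgue R]_x h (circle_val x))).
- have [D Z [K LK]] := bounded_functional_Rintegral (@circle_lebesgue R).
  have bc (f : R -> R) : @bmeas R _ (measurableTypeR R) f -> bmeas (f \o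
    @circle_val R).
    by apply: bmeas_comp; exact: measurable_circle_val.
  split=> [f g bf bg|c f bf|].
  + exact: D (bc _ bf) (bc _ bg).
  + exact: Z (bc _ bf).
  + by exists K => f M bf fM; apply: LK => //; exact: bc.
- exact: bounded_functional_itv01.
(* The circle is [0, 1) while the target interval is closed; the endpoint 1 is a null set. *)
move=> A mA; rewrite -Rintegral_itv_bndo_bndc; last first.
  have ih := integrable_bmeas_itv 0 1 (bmeas_indic R mA).
  apply: integrableS ih => //.
  by apply: subset_itv; rewrite bnd_simp.
rewrite (_ : (fun x : circle R => _) = \1_(@circle_val R @^-1` A)); last first.
  by apply/funext => x; rewrite !indicE.
have mA' : measurable (@circle_val R @^-1` A).
  by rewrite -[X in measurable X]setTI; exact: measurable_circle_val.
rewrite Rintegral_indicT// /Rintegral integral_indic//=.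
congr fine; rewrite /circle_lebesgue; congr (lebesgue_measure _).
apply/seteqP; split=> [_ [x Ax <-]|x [Ax]].
  by split => //; rewrite /= in_itv/=; exact: (valP x).
by rewrite /= in_itv/= => x01; exists (exist _ x x01).
Qed.

Lemma continuous_bmeas_bounded (h : R -> R) (M : R) :
  continuous h -> (forall x, `|h x| <= M) -> @bmeas R _ (measurableTypeR R) h.
Proof.
by move=> ch hM; split; [exact: continuous_measurable_fun|exists M].
Qed.

Lemma Rintegral_FTC2 (a b : R) (f F : R -> R) : a < b -> continuous f ->
  {in `[a, b], forall x : R, is_derive x 1 F (f x)} ->
  \int[mu]_(x in `[a, b]) f x = F b - F a.
Proof.
move=> ab cf dF; rewrite /Rintegral (@continuous_FTC2 _ f F)//.
- exact: continuous_subspaceT.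
- have cF x : x \in `[a, b] -> {for x, continuous F}.
    move=> /dF [dFx _]; apply: differentiable_continuous.
    exact/derivable1_diffP.
  split.
  + by move=> x /subset_itv_oo_cc /dF [].
  + by apply: cvg_at_right_filter; apply: cF; rewrite bound_itvE ltW.
  + by apply: cvg_at_left_filter; apply: cF; rewrite bound_itvE ltW.
- by move=> x /subset_itv_oo_cc /dF [_ <-]; rewrite derive1E.
Qed.

Lemma continuous_primitive (h : R -> R) (a b : R) : continuous h ->
  exists F : R -> R, forall x, a < x < b -> is_derive x 1 F (h x).
Proof.
move=> ch; exists (fun x => \int[mu]_(t in `[a, x]) h t) => x /andP[ax xb].
have ih : mu.-integrable `[a, b] (EFin \o h).
  apply: continuous_compact_integrable; first exact: segment_compact.
  exact: continuous_subspaceT.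
have [dF F'] := continuous_FTC1_closed xb ih ax (ch x).
by split => //; rewrite -F' derive1E.
Qed.

(* A primitive [F] of [h] and its shift [F (x - 1)] are both primitives of the
   1-periodic function [h] on [1 - y, 1]. *)
Lemma Rintegral_periodic_shift (h : R -> R) (y : R) : continuous h ->
  (forall x, h (x - 1) = h x) -> 0 <= y < 1 ->
  \int[mu]_(x in `[0, 1]) h (x - y) = \int[mu]_(x in `[0, 1]) h x.
Proof.
move=> ch h1 /andP[]; rewrite le_eqVlt => /predU1P[<- _|y0 y1].
  by under eq_Rintegral do rewrite subr0.
(* The interval (-2, 2) contains [0, 1] and all the shifted arguments below, so one primitive serves
   for every integral. *)
have [F dF] := continuous_primitive (-2) 2 ch.
have chs (c : R) : continuous (fun x => h (x - c)).
  by move=> x; apply: continuous_comp; [exact: cvgB cvg_id (cvg_cst _)|exact: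
    ch].
have dFs (c x : R) : -2 < x - c < 2 -> is_derive x 1 (fun x => F (x - c)) (h (x
  - c)).
  move=> /dF dFxc; rewrite -[h _]mulr1.
  apply: (@is_derive1_comp _ F (fun x => x - c)) => //.
  by rewrite -[X in is_derive _ _ _ X]subr0; exact: is_deriveB.
have -> : \int[mu]_(x in `[0, 1]) h (x - y) = F (1 - y) - F (0 - y).
  apply: (@Rintegral_FTC2 _ _ _ (fun x => F (x - y))) => // x.
  by rewrite in_itv/= => /andP[? ?]; apply: dFs; apply/andP; split; lra.
have -> : \int[mu]_(x in `[0, 1]) h x = F 1 - F 0.
  apply: Rintegral_FTC2 => // x; rewrite in_itv/= => /andP[? ?].
  by apply: dF; apply/andP; split; lra.
have y1' : 1 - y < 1 by lra.
have e1 : \int[mu]_(x in `[1 - y, 1]) h x = F 1 - F (1 - y).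
  apply: Rintegral_FTC2 => // x; rewrite in_itv/= => /andP[? ?].
  by apply: dF; apply/andP; split; lra.
have e2 : \int[mu]_(x in `[1 - y, 1]) h (x - 1) = F (1 - 1) - F (1 - y - 1).
  apply: (@Rintegral_FTC2 _ _ _ (fun x => F (x - 1))) => // x.
  by rewrite in_itv/= => /andP[? ?]; apply: dFs; apply/andP; split; lra.
have e3 : F 1 - F (1 - y) = F 0 - F (- y).
  rewrite -e1 (_ : F 0 - F (- y) = F (1 - 1) - F (1 - y - 1)); last first.
    by congr (F _ - F _); ring.
  by rewrite -e2; apply: eq_Rintegral => x _; rewrite h1.
by rewrite sub0r; lra.
Qed.

End circle_integral.

(** * Cosine coefficients of the distance to the nearest integer *)

Section fejer_moments.
Variable R : realType.
Notation mu := (@lebesgue_measure R).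
Implicit Types (k n : nat) (x w : R).

Lemma cos_pin k : cos (pi * k%:R) = (-1) ^+ k :> R.
Proof.
elim: k => [|k ih]; first by rewrite mulr0 cos0.
by rewrite -natr1 mulrDr mulr1 cosDpi ih exprS mulN1r.
Qed.

Lemma sin_pin k : sin (pi * k%:R) = 0 :> R.
Proof.
elim: k => [|k ih]; first by rewrite mulr0 sin0.
by rewrite -natr1 mulrDr mulr1 sinDpi ih oppr0.
Qed.

Lemma cos_2pin k : cos (2 * pi * k%:R) = 1 :> R.
Proof. by rewrite mulrAC mulrC -natrM cos_pin -signr_odd oddM. Qed.

Lemma sin_2pin k : sin (2 * pi * k%:R) = 0 :> R.
Proof. by rewrite mulrAC mulrC -natrM sin_pin. Qed.

Lemma is_derive_cosM w x :
  is_derive x 1 (fun y => cos (w * y)) (- w * sin (w * x)).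
Proof.
rewrite mulrC mulrN -mulNr; apply: (@is_derive1_comp _ cos ( *%R w)).
by rewrite -[X in is_derive _ _ _ X]mulr1; exact: is_deriveZ.
Qed.

Lemma is_derive_sinM w x :
  is_derive x 1 (fun y => sin (w * y)) (w * cos (w * x)).
Proof.
rewrite mulrC; apply: (@is_derive1_comp _ sin ( *%R w)).
by rewrite -[X in is_derive _ _ _ X]mulr1; exact: is_deriveZ.
Qed.

Lemma continuous_cosM w : continuous (fun x => cos (w * x)).
Proof.
move=> x; apply/differentiable_continuous/derivable1_diffP.
by have [] := is_derive_cosM w x.
Qed.

Lemma bmeas_cosM w : @bmeas R _ (measurableTypeR R) (fun x => cos (w * x)).
Proof.
by apply: (@continuous_bmeas_bounded _ _ 1); [exact: continuous_cosM|move=> x;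
  exact: cos_max].
Qed.

Lemma bmeas_nid : @bmeas R _ (measurableTypeR R) (@nid R).
Proof.
apply: (@continuous_bmeas_bounded _ _ 1); first exact: continuous_nid.
by move=> x; rewrite ger0_norm ?nid_ge0// nid_le1.
Qed.

Lemma Rintegral_cos k : (0 < k)%N ->
  \int[mu]_(x in `[0, 1]) cos (2 * pi * k%:R * x) = 0.
Proof.
move=> k0; set w := 2 * pi * k%:R.
have w0 : w != 0 by rewrite !mulf_neq0 ?pnatr_eq0 ?gt_eqF ?pi_gt0// -lt0n.
rewrite (@Rintegral_FTC2 _ _ _ _ (fun x => w^-1 * sin (w * x)))//.
- by rewrite mulr1 mulr0 sin0 sin_2pin subrr.
- exact: continuous_cosM.
- move=> x _; rewrite -[X in is_derive _ _ _ X](mulKf w0).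
  by apply: is_deriveZ; exact: is_derive_sinM.
Qed.

Lemma Rintegral_itv01_split (f : R -> R) : @bmeas R _ (measurableTypeR R) f ->
  \int[mu]_(x in `[0, 1]) f x =
  \int[mu]_(x in `[0, 2^-1]) f x + \int[mu]_(x in `[2^-1, 1]) f x.
Proof.
move=> bf; have i01 := integrable_bmeas_itv 0 1 bf.
have := @Rintegral_itvB _ f (BLeft 0) (BRight 1) 2^-1 i01.
rewrite !bnd_simp => /(_ _ _)/eqP.
rewrite subr_eq addrC => /(_ _ _)/eqP -> //; try by lra.
rewrite Rintegral_itv_obnd_cbnd//.
have ih := integrable_bmeas_itv 2^-1 1 bf.
by apply: integrableS ih => //; apply: subset_itv; rewrite bnd_simp.
Qed.

Lemma Rintegral_nid : \int[mu]_(x in `[0, 1]) nid x = 4^-1.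
Proof.
rewrite Rintegral_itv01_split; last exact: bmeas_nid.
have -> : \int[mu]_(x in `[0, 2^-1]) nid x = 8^-1.
  rewrite (@eq_Rintegral _ _ _ mu _ (fun x => x)); last first.
    by move=> x; rewrite inE/= in_itv/=; exact: nid_lower.
  rewrite (@Rintegral_FTC2 _ _ _ _ (fun x => 2^-1 * x ^+ 2));
    [|lra|by move=> x|].
    by lra.
  move=> x _; apply: is_derive_eq; rewrite /GRing.scale/=; lra.
have -> : \int[mu]_(x in `[2^-1, 1]) nid x = 8^-1.
  rewrite (@eq_Rintegral _ _ _ mu _ (fun x => 1 - x)); last first.
    by move=> x; rewrite inE/= in_itv/=; exact: nid_upper.
  rewrite (@Rintegral_FTC2 _ _ _ _ (fun x => x - 2^-1 * x ^+ 2)); [|lra| |].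
  - by lra.
  - by move=> x; apply: cvgB; [exact: cvg_cst|exact: cvg_id].
  - move=> x _; apply: is_derive_eq; rewrite /GRing.scale/=; lra.
lra.
Qed.

(** With w = 2 pi k, integration by parts on each half gives ((-1)^k - 1)/w^2: at 0, 1/2, 1 the sine
    of wx vanishes and the cosine is 1, (-1)^k, 1. The halves agree by the symmetry of [nid] about
    1/2, and even frequencies drop out. *)
Lemma Rintegral_nid_cos k : (0 < k)%N ->
  \int[mu]_(x in `[0, 1]) (nid x * cos (2 * pi * k%:R * x)) =
  ((-1) ^+ k - 1) / (2 * pi ^+ 2 * k%:R ^+ 2).
Proof.
move=> k0; set w := 2 * pi * k%:R.
have pi0 : pi != 0 :> R by rewrite gt_eqF ?pi_gt0.
have kn0 : k%:R != 0 :> R by rewrite pnatr_eq0 -lt0n.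
have w0 : w != 0 by rewrite !mulf_neq0 ?pnatr_eq0 -?lt0n.
have cw : cos (w * 2^-1) = (-1) ^+ k.
  by rewrite -cos_pin /w; congr cos; field.
have sw : sin (w * 2^-1) = 0.
  by rewrite -(sin_pin k) /w; congr sin; field.
rewrite Rintegral_itv01_split; last by apply: bmeasM;
  [exact: bmeas_nid|exact: bmeas_cosM].
have -> : \int[mu]_(x in `[0, 2^-1]) (nid x * cos (w * x)) = ((-1) ^+ k - 1) /
  w ^+ 2.
  rewrite (@eq_Rintegral _ _ _ mu _ (fun x => x * cos (w * x))); last first.
    by move=> x; rewrite inE/= in_itv/= => x01; rewrite nid_lower.
  rewrite (@Rintegral_FTC2 _ _ _ _
    (fun x => w^-1 * (x * sin (w * x)) + w ^- 2 * cos (w * x))).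
  - by rewrite cw sw !(mulr0, mul0r) cos0; field.
  - lra.
  - by move=> x; apply: cvgM; [exact: cvg_id|exact: continuous_cosM].
  - move=> x _; have dc := is_derive_cosM w x; have ds := is_derive_sinM w x.
    by apply: is_derive_eq; rewrite /GRing.scale/=; field.
have -> : \int[mu]_(x in `[2^-1, 1]) (nid x * cos (w * x)) = ((-1) ^+ k - 1) /
  w ^+ 2.
  rewrite (@eq_Rintegral _ _ _ mu _ (fun x => (1 - x) * cos (w * x)));
    last first.
    by move=> x; rewrite inE/= in_itv/= => x01; rewrite nid_upper.
  rewrite (@Rintegral_FTC2 _ _ _ _
    (fun x => w^-1 * ((1 - x) * sin (w * x)) - w ^- 2 * cos (w * x))).
  - by rewrite cw sw !mulr1 cos_2pin sin_2pin; field.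
  - lra.
  - move=> x; apply: cvgM; last exact: continuous_cosM.
    by apply: cvgB; [exact: cvg_cst|exact: cvg_id].
  - move=> x _; have dc := is_derive_cosM w x; have ds := is_derive_sinM w x.
    by apply: is_derive_eq; rewrite /GRing.scale/=; field.
by rewrite /w; move: kn0 pi0; move: (k%:R) (pi : R) => x p x0 p0; field;
  rewrite x0 p0.
Qed.

Lemma Rintegral_mul_fejer (g : R -> R) n : @bmeas R _ (measurableTypeR R) g ->
  \int[mu]_(x in `[0, 1]) (g x * fejerR n x) =
  \int[mu]_(x in `[0, 1]) g x + 2 * \sum_(1 <= k < n.+1) fejer_coef R n k *
    \int[mu]_(x in `[0, 1]) (g x * cos (2 * pi * k%:R * x)).
Proof.
move=> bg; have bL := bounded_functional_itv01 R; have [LD LZ _] := bL.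
have bgc k : @bmeas R _ (measurableTypeR R) (fun x => g x * cos (2 * pi * k%:R
  * x)).
  by apply: bmeasM => //; exact: bmeas_cosM.
rewrite (_ : (fun x => _) = (fun x => g x + 2 * \sum_(1 <= k < n.+1)
    fejer_coef R n k * (g x * cos (2 * pi * k%:R * x)))); last first.
  apply/funext => x; rewrite /fejerR mulrDr mulr1 mulrCA; congr (_ + 2 * _).
  by rewrite mulr_sumr; apply: eq_bigr => k _; rewrite mulrCA.
rewrite LD//; last by apply/bmeasZ/bmeas_sum => k; exact: bmeasZ.
rewrite LZ; last by apply/bmeas_sum => k; exact: bmeasZ.
rewrite (bounded_functional_sum bL); last by move=> k; exact: bmeasZ.
by congr (_ + 2 * _); apply: eq_bigr => k _; rewrite LZ.
Qed.

(* The integral of [nid] against [fejerR n], by [Rintegral_nid_fejer]; the last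
   factor is the [k]-th cosine coefficient of [nid]. *)
Definition fejer_moment n : R := 4^-1 + 2 * \sum_(1 <= k < n.+1)
  fejer_coef R n k * (((-1) ^+ k - 1) / (2 * pi ^+ 2 * k%:R ^+ 2)).

Lemma bmeas_fejerR n : @bmeas R _ (measurableTypeR R) (@fejerR R n).
Proof.
apply: bmeasD; first exact: bmeas_cst.
by apply/bmeasZ/bmeas_sum => k; apply/bmeasZ/bmeas_cosM.
Qed.

Lemma Rintegral_itv01_cst (c : R) : \int[mu]_(x in `[0%R, 1%R]) c = c.
Proof.
by rewrite Rintegral_cst//= lebesgue_measure_itv/= lte_fin ltr01 oppr0 adde0
  mulr1.
Qed.

Lemma Rintegral_fejer n : \int[mu]_(x in `[0, 1]) fejerR n x = 1.
Proof.
under eq_Rintegral do rewrite -[fejerR _ _]mul1r.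
rewrite (@Rintegral_mul_fejer (fun=> 1)); last exact: bmeas_cst.
rewrite Rintegral_itv01_cst big_nat big1 ?mulr0 ?addr0// => k /andP[k0 _].
by under eq_Rintegral do rewrite mul1r; rewrite Rintegral_cos ?mulr0.
Qed.

Lemma Rintegral_nid_fejer n :
  \int[mu]_(x in `[0, 1]) (nid x * fejerR n x) = fejer_moment n.
Proof.
rewrite Rintegral_mul_fejer; last exact: bmeas_nid.
rewrite Rintegral_nid; congr (_ + 2 * _).
by apply: eq_big_nat => k /andP[k0 _]; rewrite Rintegral_nid_cos.
Qed.

End fejer_moments.

(** * Decay of the first moment *)

Section fejer_moment_limit.
Variable R : realType.
Notation mu := (@lebesgue_measure R).
Implicit Types (k n : nat) (x t s : R).

(** By the mean value theorem sin(s/2) = (s/2) cos c, so sin s = s cos(s/2) cos c. Both angles lie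
    in [0, pi/4], where the cosine is at least cos(pi/4), whose square is 1/2. *)
Lemma half_le_sin s : 0 <= s <= pi / 2 -> s / 2 <= sin s.
Proof.
move=> /andP[s0 s1].
have pi0 := pi_gt0 R.
have [c cI E] : exists2 c, c \in `[0, s / 2] & sin (s / 2) - sin 0 = cos c * (s
  / 2 - 0).
  apply: MVT_segment; first by lra.
  exact/continuous_subspaceT/continuous_sin.
move: cI E; rewrite in_itv/= sin0 !subr0 => /andP[c0 c1] E.
have q2 : cos (pi / 4) ^+ 2 = 2^-1 :> R.
  have := cos_mulr2n (pi / 4 : R); rewrite (_ : pi / 4 *+ 2 = pi / 2);
    last by field.
  by rewrite cos_pihalf => H; lra.
have q0 : 0 <= cos (pi / 4) :> R by apply: cos_ge0_pihalf; apply/andP; split;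
  lra.
have le_cos (y : R) : 0 <= y <= pi / 4 -> cos (pi / 4) <= cos y.
  move=> /andP[y0 y1]; have [yp|yp] := eqVneq y (pi / 4); first by rewrite yp.
  apply/ltW; rewrite ltr_cos ?in_itv/=; first by rewrite lt_neqAle yp.
  - by apply/andP; split; lra.
  - by apply/andP; split; lra.
have cc : cos (pi / 4) <= cos c by apply: le_cos; apply/andP; split; lra.
have ch : cos (pi / 4) <= cos (s / 2) by apply: le_cos; apply/andP; split; lra.
rewrite [X in sin X](_ : s = (s / 2) *+ 2); last by field.
rewrite sin_mulr2n E.
have h0 : 0 <= s / 2 by lra.
have : cos (pi / 4) ^+ 2 <= cos (s / 2) * cos c by rewrite expr2 ler_pM.
rewrite q2 => /(ler_wpM2r h0).
by move: (cos (s / 2)) (cos c) => A B H; lra.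
Qed.

(** On [0, 1/2] one has 1 - cos(2 pi t) = 2 sin(pi t)^2, and sin(pi t) >= pi t/2 >= t because pi >=
    2. The other half follows by t -> 1 - t. *)
Lemma sqr_nid_le x : 0 <= x <= 1 -> nid x ^+ 2 <= 1 - cos (2 * pi * x).
Proof.
have pi0 := pi_gt0 R; have pi2 := pi_ge2 R.
have key (t : R) : 0 <= t <= 2^-1 -> t ^+ 2 <= 1 - cos (2 * pi * t).
  move=> /andP[t0 t1].
  have := @half_le_sin (pi * t).
  rewrite mulr_ge0 ?(ltW pi0)//= ler_pM2l// => /(_ t1) sl.
  rewrite (_ : 2 * pi * t = (pi * t) *+ 2); last by rewrite mulr2n; ring.
  rewrite cos_mulr2n cos2sin2.
  have : t <= sin (pi * t) by apply: le_trans sl; nra.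
  by rewrite mulr2n; nra.
move=> /andP[x0 x1]; have [xh|xh] := leP x 2^-1.
  by rewrite nid_lower ?x0//; apply: key; rewrite x0.
rewrite nid_upper; last by rewrite (ltW xh).
rewrite (_ : cos _ = cos (2 * pi * (1 - x))).
  by apply: key; apply/andP; split; lra.
rewrite mulrBr mulr1 cosB (_ : 2 * pi = pi *+ 2); last by rewrite mulr2n; ring.
by rewrite cos2pi sin2pi mul1r mul0r addr0.
Qed.

(** Product-to-sum leaves the frequencies k+1 and k-1; the mean is nonzero only when k-1 = 0. *)
Lemma Rintegral_cos1_cos k : (0 < k)%N ->
  \int[mu]_(x in `[0, 1]) (cos (2 * pi * x) * cos (2 * pi * k%:R * x)) = (k ==
    1)%:R / 2.
Proof.
move=> k0; have [LD LZ _] := bounded_functional_itv01 R.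
rewrite (_ : (fun x => _) = (fun x => 2^-1 *
    (cos (2 * pi * k.+1%:R * x) + cos (2 * pi * k.-1%:R * x)))); last first.
  apply/funext => x; set a := 2 * pi * x; set b := 2 * pi * k%:R * x.
  have -> : 2 * pi * k.+1%:R * x = b + a by rewrite /a /b -natr1; ring.
  have -> : 2 * pi * k.-1%:R * x = b - a.
    by rewrite /a /b -[in k%:R](prednK k0) -natr1; ring.
  by rewrite cosD cosB; field.
rewrite LZ; last by apply: bmeasD; exact: bmeas_cosM.
rewrite LD; [|exact: bmeas_cosM..].
rewrite Rintegral_cos// add0r mulrC.
case: k k0 => [//|[|k] _]; last by rewrite Rintegral_cos.
congr (_ * _); rewrite -[RHS](Rintegral_itv01_cst (1 : R)); congr Rintegral.
by apply/funext => x; rewrite mulr0 mul0r cos0.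
Qed.

(** Only the first Fejer coefficient meets the cosine, leaving 1 - (1 - 1/(n+1)). *)
Lemma Rintegral_onemcos_fejer n :
  \int[mu]_(x in `[0, 1]) ((1 - cos (2 * pi * x)) * fejerR n x) = n.+1%:R^-1.
Proof.
have bL := bounded_functional_itv01 R.
have bc := bmeas_cosM (2 * pi : R).
have bck k := bmeas_cosM (2 * pi * k%:R : R).
have b1 := @bmeas_cst R _ (measurableTypeR R) 1.
rewrite Rintegral_mul_fejer; last exact: bmeasB.
rewrite (bounded_functionalB bL)//= Rintegral_itv01_cst.
have -> : \int[mu]_(x in `[0, 1]) cos (2 * pi * x) = 0.
  by have := @Rintegral_cos R 1 isT; under eq_Rintegral do rewrite mulr1.
rewrite (eq_big_nat _ _ (F2 := fun k => - (fejer_coef R n k * ((k == 1)%:R /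
  2)))); last first.
  move=> k /andP[k0 _]; rewrite -mulrN; congr (_ * _).
  under eq_Rintegral do rewrite mulrBl mul1r.
  rewrite (bounded_functionalB bL)//; last exact: bmeasM.
  by rewrite Rintegral_cos// sub0r Rintegral_cos1_cos.
(* For n = 0 the kernel has no frequency 1 and the integral is 1. *)
case: n => [|n]; first by rewrite big_geq// mulr0 addr0 subr0 invr1.
rewrite big_ltn// eqxx big_nat big1 => [|k /andP[k1 _]]; last first.
  by rewrite gtn_eqF// mul0r mulr0 oppr0.
have n0 : n.+2%:R != 0 :> R by rewrite pnatr_eq0.
by rewrite /fejer_coef mulr1n; field.
Qed.

Lemma fejer_moment_ge0 n : 0 <= fejer_moment R n.
Proof.
rewrite -Rintegral_nid_fejer; apply: Rintegral_ge0 => x _.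
by rewrite mulr_ge0 ?nid_ge0 ?fejerR_ge0.
Qed.

(** Pointwise [nid x] <= e + [nid x]^2/e, since e * [nid x] <= e^2 + [nid x]^2; the square is then
    dominated by 1 - cos(2 pi x). *)
Lemma fejer_moment_le n (e : R) : 0 < e ->
  fejer_moment R n <= e + e^-1 / n.+1%:R.
Proof.
move=> e0; have bL := bounded_functional_itv01 R; have [LD LZ _] := bL.
have bF := bmeas_fejerR R n.
have bc : @bmeas R _ (measurableTypeR R) (fun x => (1 - cos (2 * pi * x)) *
  fejerR n x).
  apply: bmeasM => //; apply: bmeasB; [exact: bmeas_cst|exact: bmeas_cosM].
have -> : e + e^-1 / n.+1%:R = \int[mu]_(x in `[0, 1])
    (e * fejerR n x + e^-1 * ((1 - cos (2 * pi * x)) * fejerR n x)).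
  rewrite LD; [|exact: bmeasZ..].
  by rewrite !LZ// Rintegral_onemcos_fejer Rintegral_fejer mulr1.
rewrite -Rintegral_nid_fejer.
apply: le_Rintegral => //.
- by apply/integrable_bmeas_itv/bmeasM => //; exact: bmeas_nid.
- by apply/integrable_bmeas_itv/bmeasD; exact: bmeasZ.
move=> x; rewrite /= in_itv/= => /sqr_nid_le nx.
rewrite mulrA -mulrDl ler_wpM2r ?fejerR_ge0//.
rewrite -(ler_pM2l e0) mulrDr mulrA divff ?gt_eqF// mul1r.
by apply: le_trans (lerD (lexx _) nx); nra.
Qed.

End fejer_moment_limit.

(** * Two-sided bounds for the first moment *)

Section fejer_moment_bounds.
Variable R : realType.
Implicit Types (m n M : nat).

Definition oddV m : R := m.*2.+1%:R^-1.
Definition odd_harmonic m : R := \sum_(j < m) oddV j.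
Definition odd_zeta2 m : R := \sum_(j < m) oddV j ^+ 2.

Let oddE m : m.*2.+1%:R = 2 * m%:R + 1 :> R.
Proof. by rewrite -natr1 -mul2n natrM. Qed.

(** There are [uphalf n] odd numbers up to n, which explains the range of all the odd sums below. *)
Lemma sum_odd_reindex (G : nat -> R) n :
  \sum_(1 <= k < n.+1) (if odd k then G k else 0) = \sum_(j < uphalf n) G
    j.*2.+1.
Proof.
elim: n => [|n ih]; first by rewrite big_geq// big_ord0.
rewrite big_nat_recr//= ih; case: ifPn => on.
  by rewrite uphalf_half (negPf on) add0n big_ord_recr/= even_halfK.
by rewrite addr0 uphalf_half; rewrite negbK in on; rewrite on.
Qed.

Lemma fejer_momentE n : pi ^+ 2 * fejer_moment R n =
  2 * (pi ^+ 2 / 8 - odd_zeta2 (uphalf n) + odd_harmonic (uphalf n) / n.+1%:R).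
Proof.
rewrite /fejer_moment /odd_zeta2 /odd_harmonic.
have pi0 : pi != 0 :> R by rewrite gt_eqF ?pi_gt0.
have n0 : n.+1%:R != 0 :> R by rewrite pnatr_eq0.
rewrite (eq_big_nat _ _ (F2 := fun k => if odd k then
    - (pi ^- 2) * (k%:R^-1 ^+ 2 - k%:R^-1 / n.+1%:R) else 0)); last first.
  move=> k /andP[k0 _]; rewrite -signr_odd; case: (odd k); last first.
    by rewrite expr0 subrr mul0r mulr0.
  have kn0 : k%:R != 0 :> R by rewrite pnatr_eq0 -lt0n.
  rewrite /fejer_coef; move: kn0 pi0 n0.
  by move: (k%:R) (pi : R) (n.+1%:R) => x p y x0 p0 y0; field; rewrite x0 p0 y0.
rewrite (sum_odd_reindex (fun k => - (pi ^- 2) * (k%:R^-1 ^+ 2 - k%:R^-1 /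
  n.+1%:R))).
rewrite -mulr_sumr sumrB -mulr_suml.
rewrite -/(oddV _).
move: pi0 n0; move: (\sum_(_ < _) _) (\sum_(_ < _) _) (pi : R) (n.+1%:R) => a b
  p y p0 y0.
by field; rewrite p0 y0.
Qed.

(** Telescoping: 1/(2M+1)^2 <= 1/(4M(M+1)) = 1/(4M) - 1/(4(M+1)). *)
Lemma odd_zeta2_ub m M : (0 < m)%N -> (m <= M)%N ->
  odd_zeta2 M <= odd_zeta2 m + (4 * m%:R)^-1 - (4 * M%:R)^-1.
Proof.
move=> m0; elim: M => [|M ih]; first by rewrite leqn0 => /eqP mz;
  rewrite mz in m0.
rewrite leq_eqVlt => /predU1P[->|]; first by rewrite addrK.
rewrite ltnS => mM; have := ih mM; rewrite /odd_zeta2 big_ord_recr/=.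
have M0 : 0 < M%:R :> R by rewrite ltr0n (leq_trans m0).
suff : oddV M ^+ 2 <= (4 * M%:R)^-1 - (4 * M.+1%:R)^-1.
  by move=> H1 H2; apply: le_trans (lerD H2 H1) _; rewrite addrA subrK.
rewrite /oddV oddE -[M.+1%:R]natr1; move: (M%:R) M0 => x x0.
rewrite (_ : _ - _ = (4 * x * (x + 1))^-1); last by field; apply/andP; split;
  apply: lt0r_neq0; lra.
rewrite exprVn lef_pV2 ?posrE; first by nra.
- by apply: exprn_gt0; lra.
- by apply: mulr_gt0; lra.
Qed.

(** Telescoping from the other side: 1/(2M+1)^2 >= 1/((2M+1)(2M+3)), half the difference of
    consecutive [oddV]. *)
Lemma odd_zeta2_lb m M : (m <= M)%N ->
  odd_zeta2 m + oddV m / 2 - oddV M / 2 <= odd_zeta2 M.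
Proof.
elim: M => [|M ih]; first by rewrite leqn0 => /eqP ->; rewrite addrK.
rewrite leq_eqVlt => /predU1P[->|]; first by rewrite addrK.
rewrite ltnS => mM; have := ih mM; rewrite /odd_zeta2 big_ord_recr/=.
suff : oddV M / 2 - oddV M.+1 / 2 <= oddV M ^+ 2 by lra.
rewrite /oddV !oddE -[M.+1%:R]natr1; have : 0 <= M%:R :> R by [].
move: (M%:R) => x x0.
rewrite (_ : _ - _ = ((2 * x + 1) * (2 * x + 3))^-1); last first.
  by field; apply/andP; split; apply: lt0r_neq0; lra.
rewrite exprVn lef_pV2 ?posrE; first by nra.
- by apply: mulr_gt0; lra.
- by apply: exprn_gt0; lra.
Qed.

(** The increment of the logarithm is ln(1 + 2/(2m+1)) <= 2/(2m+1). *)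
Lemma odd_harmonic_lb m : ln (m.*2.+1%:R : R) <= 2 * odd_harmonic m.
Proof.
elim: m => [|m ih]; first by rewrite ln1 /odd_harmonic big_ord0 mulr0.
rewrite /odd_harmonic big_ord_recr/= mulrDr.
apply: le_trans (lerD ih (lexx _)).
have x0 : 0 < m.*2.+1%:R :> R by [].
have -> : m.+1.*2.+1%:R = m.*2.+1%:R * (1 + 2 * oddV m) :> R.
  by rewrite /oddV doubleS -[m.*2.+3%:R]natr1 -[m.*2.+2%:R]natr1; field.
have v0 : 0 < oddV m by rewrite invr_gt0.
rewrite lnM ?posrE//; last by lra.
by rewrite lerD2l le_ln1Dx//; lra.
Qed.

(** The inequality ln(1 + x) <= x again, now at x = -2/(2m+3). The summand 2 is the first term of
    the sum, whose logarithm is 0. *)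
Lemma odd_harmonic_ub m : 2 * odd_harmonic m.+1 <= 2 + ln (m.*2.+1%:R : R).
Proof.
elim: m => [|m ih].
  by rewrite ln1 /odd_harmonic big_ord1 /oddV invr1; lra.
rewrite /odd_harmonic big_ord_recr/= -/(odd_harmonic _) mulrDr.
apply: le_trans (lerD ih (lexx _)) _.
have x0 : 0 < m.*2.+1%:R :> R by [].
have v0 : 0 < oddV m.+1 by rewrite invr_gt0.
have xE : m.*2.+1%:R = m.+1.*2.+1%:R * (1 - 2 * oddV m.+1) :> R.
  rewrite /oddV doubleS -[m.*2.+3%:R]natr1 -[m.*2.+2%:R]natr1; field.
  by apply: lt0r_neq0; lra.
have v1 : 0 < 1 - 2 * oddV m.+1.
  by move: x0; rewrite xE pmulr_rgt0.
rewrite {1}xE lnM ?posrE//.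
have : ln (1 + - (2 * oddV m.+1)) <= - (2 * oddV m.+1) by apply: le_ln1Dx; lra.
lra.
Qed.

(** A passage to the limit in two stages: [e] is fixed first, then [M] is taken so large that the
    second error falls below [e]. The cap [e] <= 1 lets a caller absorb a bare [oddV M] into
    [e^-1 * oddV M]. *)
Lemma le0_of_small_error (a c : R) m : 0 < c ->
  (forall (e : R) M, 0 < e <= 1 -> (m <= M)%N -> a <= c * (e + e^-1 * oddV M))
    ->
  a <= 0.
Proof.
move=> c0 H; rewrite leNgt; apply/negP => a0.
pose e := Num.min 1 (a / (2 * c)).
have e0 : 0 < e by rewrite lt_min ltr01 divr_gt0// mulr_gt0.
have e1 : e <= 1 by rewrite ge_min lexx.
have ea : e * (2 * c) <= a by rewrite -ler_pdivlMr ?mulr_gt0// ge_min lexx orbT.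
(* Beyond e^-2, [oddV M] = 1/(2M+1) is smaller than e^2. *)
pose M := maxn m (Num.truncn (e ^- 2)).+1.
have := H e M; rewrite e0 e1 leq_maxl => /(_ isT isT).
suff : e^-1 * oddV M < e by nra.
have eM : e ^- 2 < M%:R.
  by apply: lt_le_trans (truncnS_gt _) _; rewrite ler_nat leq_maxr.
rewrite /oddV oddE -invfM -(invrK e) ltf_pV2 ?posrE ?invr_gt0//; last first.
  by rewrite invrK; have : 0 <= M%:R :> R by []; nra.
rewrite invrK mulrC -ltr_pdivrMr//.
apply: le_lt_trans (_ : e ^- 2 < _); first by rewrite expr2 invfM.
by have : 0 <= M%:R :> R by []; lra.
Qed.

Let uphalf_dbl M : uphalf M.*2 = M.
Proof. by rewrite uphalf_half odd_double half_double. Qed.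

(** At n = 2M there are M odd frequencies and 1/(n+1) is [oddV M]. Dropping the nonnegative harmonic
    term, smallness of the moment bounds pi^2/8 by [odd_zeta2 M] plus an error; telescoping goes
    back from M to m. *)
Lemma odd_zeta2_sum_le m : (0 < m)%N ->
  pi ^+ 2 / 8 <= odd_zeta2 m + (4 * m%:R)^-1.
Proof.
move=> m0; rewrite -subr_le0.
have pi0 := pi_gt0 R.
apply: (@le0_of_small_error _ (pi ^+ 2) m); first exact: exprn_gt0.
move=> e M /andP[e0 e1] mM.
have M0 : 0 <= (4 * M%:R)^-1 :> R by rewrite invr_ge0 mulr_ge0.
have := odd_zeta2_ub m0 mM.
have := fejer_momentE M.*2; rewrite uphalf_dbl -/(oddV M).
have h0 : 0 <= odd_harmonic M * oddV M.
  by rewrite mulr_ge0 ?invr_ge0// sumr_ge0// => i _; rewrite invr_ge0.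
have := @fejer_moment_le R M.*2 e e0; rewrite -/(oddV M).
rewrite -(@ler_pM2l _ (pi ^+ 2)) ?exprn_gt0//.
have : 0 <= pi ^+ 2 * (e + e^-1 * oddV M).
  by rewrite mulr_ge0 ?sqr_ge0// addr_ge0 ?(ltW e0)// mulr_ge0 ?invr_ge0// ltW.
lra.
Qed.

(** Positivity of the moment at n = 2M bounds pi^2/8 below by [odd_zeta2 M] minus
    [odd_harmonic M * oddV M]. What remains is to see that this product is small. *)
Lemma odd_zeta2_sum_ge m : odd_zeta2 m + oddV m / 2 <= pi ^+ 2 / 8.
Proof.
rewrite -subr_le0; apply: (@le0_of_small_error _ 2 m); first by [].
move=> e M /andP[e0 e1] mM.
have v0 : 0 < oddV M by rewrite invr_gt0.
have z2 : odd_zeta2 M <= 2.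
  case: M {mM v0} => [|M]; first by rewrite /odd_zeta2 big_ord0.
  apply: (le_trans (@odd_zeta2_ub 1 M.+1 isT isT)).
  rewrite /odd_zeta2 big_ord1 /oddV/=.
  have : 0 <= (4 * M.+1%:R)^-1 :> R by rewrite invr_ge0.
  by rewrite invr1 expr1n mulr1; move: (_^-1) => x; lra.
(* Termwise v <= e/2 + v^2/(2e). After multiplication by [oddV M] the linear part is at most e/4,
   and the quadratic part at most [e^-1 * oddV M] because [odd_zeta2 M] <= 2. *)
have hM : odd_harmonic M <= e / 2 * M%:R + e^-1 / 2 * odd_zeta2 M.
  rewrite mulr_sumr mulr_natr -[in X in X + _](card_ord M) -sumr_const
    -big_split/=.
  apply: ler_sum => j _; rewrite -(ler_pM2l e0).
  rewrite (_ : e * (_ + _) = e ^+ 2 / 2 + oddV j ^+ 2 / 2).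
    by have := sqr_ge0 (e - oddV j); nra.
  by move: (oddV j) => v; field; rewrite gt_eqF.
have MV : M%:R * oddV M <= 2^-1.
  rewrite /oddV oddE ler_pdivrMr; first by lra.
  by have : 0 <= M%:R :> R by []; lra.
have := odd_zeta2_lb mM.
have : 0 <= 2 * (pi ^+ 2 / 8 - odd_zeta2 M + odd_harmonic M * oddV M).
  have := fejer_momentE M.*2; rewrite uphalf_dbl -/(oddV M) => <-.
  by rewrite mulr_ge0 ?sqr_ge0 ?fejer_moment_ge0.
have : odd_harmonic M * oddV M <= e / 4 + e^-1 * oddV M.
  apply: (le_trans (ler_wpM2r (ltW v0) hM)).
  have ev : 0 <= e^-1 * oddV M by rewrite mulr_ge0 ?invr_ge0// ltW.
  have := ler_wpM2l (ltW e0) MV; have := ler_wpM2l ev z2.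
  by move: (e^-1) (M%:R) (oddV M) (odd_zeta2 M) => x y v z; lra.
have : oddV M <= e^-1 * oddV M by rewrite ler_pMl// invf_ge1.
lra.
Qed.

(** The constant 3 is 1 + 2: the tail of the odd squares costs 1/n, and the odd harmonic sum costs
    (2 + ln(n+1))/n after n+1 is relaxed to n in the denominator. *)
Lemma fejer_moment_ub n : (0 < n)%N ->
  fejer_moment R n <= (pi ^+ 2)^-1 * ((ln n.+1%:R + 3) / n%:R).
Proof.
move=> n0; have pi0 := pi_gt0 R.
rewrite ler_pdivlMl ?exprn_gt0// fejer_momentE.
have [m mE] : exists m, uphalf n = m.+1 by case: n n0 => [//|n _]; exists n./2.
have nm : (n <= m.+1.*2)%N by lia.
have mn : (m.*2.+1 <= n.+1)%N by lia.
have nR : 0 < n%:R :> R by rewrite ltr0n.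
have nR1 : 0 < n.+1%:R :> R by rewrite ltr0n.
rewrite mE.
have H1 : 2 * (pi ^+ 2 / 8 - odd_zeta2 m.+1) <= n%:R^-1.
  have : (2 * m.+1%:R)^-1 <= n%:R^-1 :> R.
    by rewrite lef_pV2 ?posrE ?mulr_gt0// -natrM ler_nat mul2n.
  have := @odd_zeta2_sum_le m.+1 isT.
  rewrite (_ : (4 * _)^-1 = 2^-1 * (2 * m.+1%:R)^-1); last by field.
  by move: ((2 * m.+1%:R)^-1) (n%:R^-1) => x y; lra.
have H2 : 2 * (odd_harmonic m.+1 / n.+1%:R) <= (2 + ln n.+1%:R) / n%:R.
  rewrite mulrA; apply: ler_pM.
  - by rewrite mulr_ge0// sumr_ge0// => i _; rewrite invr_ge0.
  - by rewrite invr_ge0.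
  - apply: (le_trans (odd_harmonic_ub _)); rewrite lerD2l ler_ln ?posrE//.
    by rewrite ler_nat.
  - by rewrite lef_pV2 ?posrE// ler_nat.
rewrite mulrDr; apply: (le_trans (lerD H1 H2)).
by rewrite -[X in X + _]mul1r -mulrDl; apply: ler_wpM2r;
  [rewrite invr_ge0 ltW|lra].
Qed.

(** For odd n, 2m+1 = n+2 and both terms fit directly. For even n, 2m+1 = n+1: raising the logarithm
    to ln(n+2) costs 1/(n+1)^2, which is paid for by weakening 1/(n+1) to 1/(n+3). *)
Lemma fejer_moment_lb n : (0 < n)%N ->
  (pi ^+ 2)^-1 * (ln n.+2%:R / n.+1%:R + n.+3%:R^-1) <= fejer_moment R n.
Proof.
move=> n0; have pi0 := pi_gt0 R.
rewrite ler_pdivrMl ?exprn_gt0// fejer_momentE.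
set m := uphalf n.
have H1 : oddV m <= 2 * (pi ^+ 2 / 8 - odd_zeta2 m).
  by have := odd_zeta2_sum_ge m; lra.
have nR1 : 0 < n.+1%:R :> R by rewrite ltr0n.
have H2 : ln m.*2.+1%:R / n.+1%:R <= 2 * (odd_harmonic m / n.+1%:R).
  by rewrite mulrA ler_pM2r ?invr_gt0// odd_harmonic_lb.
rewrite mulrDr addrC; apply: le_trans (lerD H1 H2).
have [on|on] := boolP (odd n).
  have mE : m.*2.+1 = n.+2 by rewrite /m; lia.
  by rewrite /oddV mE lerD2r lef_pV2 ?posrE// ler_nat.
have mE : m.*2.+1 = n.+1 by rewrite /m; lia.
rewrite /oddV mE.
have lnn : ln n.+2%:R <= ln n.+1%:R + n.+1%:R^-1 :> R.
  have -> : n.+2%:R = n.+1%:R * (1 + n.+1%:R^-1) :> R.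
    by rewrite -[n.+2%:R]natr1 mulrDr mulr1 divff// gt_eqF.
  have i0 : 0 < n.+1%:R^-1 :> R by rewrite invr_gt0.
  rewrite lnM ?posrE ?addr_gt0//.
  by rewrite lerD2l le_ln1Dx// (lt_trans _ i0)// ltrN10.
have : ln n.+2%:R / n.+1%:R <= (ln n.+1%:R + n.+1%:R^-1) / n.+1%:R :> R.
  by rewrite ler_pM2r ?invr_gt0.
rewrite mulrDl.
suff : n.+3%:R^-1 <= n.+1%:R^-1 - n.+1%:R^-1 / n.+1%:R :> R.
  move: (ln n.+2%:R) (ln n.+1%:R) (n.+3%:R^-1) (n.+1%:R^-1) => a b p q; lra.
rewrite -[n.+3%:R]natr1 -[n.+2%:R]natr1.
(* With x = n+1 the claim is x^2 <= (x-1)(x+2), that is x >= 2. *)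
have : 2 <= n.+1%:R :> R by rewrite ler_nat.
move: (n.+1%:R) => x x2.
rewrite (_ : _ - _ = (x - 1) / x ^+ 2); last by field; apply: lt0r_neq0; lra.
rewrite ler_pdivlMr ?exprn_gt0//; last by lra.
rewrite mulrC ler_pdivrMr; last by lra.
nra.
Qed.

End fejer_moment_bounds.

(** * Metric and measurable structure of the torus *)

Section torus_metric.
Context (R : realType) (d : nat).
Implicit Types x y z : torus R d.

(** The infimum over integer vectors decouples into coordinates and is attained in each of them. *)
Lemma torus_distE x y :
  torus_dist x y = \sum_(i < d) nid (torus_coord x i - torus_coord y i).
Proof.
rewrite /torus_dist; set E := (X in inf X).
have lbE : lbound E (\sum_(i < d) nid (torus_coord x i - torus_coord y i)).
  by move=> _ [k _ <-]; apply: ler_sum => i _; exact: nid_le.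
have [k kE] := choice (fun i => nid_ex (torus_coord x i - torus_coord y i)).
apply/le_anti/andP; split.
  apply: ge_inf; first by exists (\sum_(i < d) nid (torus_coord x i -
    torus_coord y i)).
  by exists k => //; apply: eq_bigr => i _; rewrite kE.
by apply: lb_le_inf => //; exists (\sum_(i < d) `|torus_coord x i - torus_coord
  y i + (k i)%:~R|), k.
Qed.

Lemma torus_dist_ge0 x y : 0 <= torus_dist x y.
Proof. by rewrite torus_distE sumr_ge0// => i _; exact: nid_ge0. Qed.

Lemma torus_dist_sym x y : torus_dist x y = torus_dist y x.
Proof.
rewrite !torus_distE; apply: eq_bigr => i _.
by rewrite -nidN opprB.
Qed.

Lemma torus_dist_triangle y x z :
  torus_dist x z <= torus_dist x y + torus_dist y z.
Proof.
rewrite !torus_distE -big_split/=; apply: ler_sum => i _.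
by apply: le_trans (nidD _ _); rewrite addrA subrK.
Qed.

Lemma torus_lip1_dist z : torus_lip1 (torus_dist z).
Proof.
move=> x y; rewrite ler_norml; apply/andP; split.
  by have := torus_dist_triangle x z y; lra.
by have := torus_dist_triangle y z x; rewrite (torus_dist_sym y x); lra.
Qed.

Definition torus_rcontinuous (f : torus R d -> R) := forall x (e : R), 0 < e ->
  exists2 r : R, 0 < r & forall y, torus_dist x y < r -> `|f x - f y| < e.

Lemma torus_lip1_continuous f : torus_lip1 f -> torus_rcontinuous f.
Proof. by move=> lf x e e0; exists e => // y; apply: le_lt_trans. Qed.

Definition to_circle (t : R) : circle R :=
  exist _ (t - (Num.floor t)%:~R) (frac_itv t).

(** The quotient map from R^d. It does not increase l1 distances although representatives jump at
    integers, and so links analysis on R^d to [torus_dist]. *)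
Definition to_torus (v : 'I_d -> R) : torus R d := [tuple to_circle (v i) | i <
  d].

Lemma to_torusE v i : torus_coord (to_torus v) i = v i - (Num.floor (v i))%:~R.
Proof. by rewrite /torus_coord tnth_mktuple. Qed.

Lemma torus_coord_itv x i : 0 <= torus_coord x i < 1.
Proof. exact: (valP (tnth x i)). Qed.

Lemma to_torusK x : to_torus (torus_coord x) = x.
Proof.
apply: eq_from_tnth => i; rewrite tnth_mktuple; apply: val_inj => /=.
rewrite (_ : Num.floor _ = 0) ?subr0//.
by apply: floor_def; exact: torus_coord_itv.
Qed.

Lemma torus_dist_to_torus v w :
  torus_dist (to_torus v) (to_torus w) <= \sum_(i < d) `|v i - w i|.
Proof.
rewrite torus_distE; apply: ler_sum => i _; rewrite !to_torusE.
set a := Num.floor (v i); set b := Num.floor (w i).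
rewrite (_ : _ - _ = v i - w i + (b - a)%:~R); last by rewrite intrB; ring.
by rewrite nid_int nid_le_norm.
Qed.

Lemma measurable_torus_coord i :
  measurable_fun [set: torus R d] (fun x : torus R d => torus_coord x i).
Proof.
apply: (@measurableT_comp _ _ _ _ _ _ (@circle_val R)).
  exact: measurable_circle_val.
exact: measurable_tnth.
Qed.

(* A continuous function is the pointwise limit of its values at the corners of
   a grid of mesh [N.+1^-1], and these depend on finitely many cells. *)
Lemma measurable_torus_rcontinuous f :
  torus_rcontinuous f -> measurable_fun [set: torus R d] f.
Proof.
move=> cf.
pose cell N (x : torus R d) : {ffun 'I_d -> 'I_N.+1} :=
  [ffun i => inord (Num.truncn (N.+1%:R * torus_coord x i))].
pose corner N (g : {ffun 'I_d -> 'I_N.+1}) : torus R d :=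
  to_torus (fun i => (g i)%:R / N.+1%:R).
have cellP N x i : (cell N x i)%:R <= N.+1%:R * torus_coord x i < (cell N x
  i).+1%:R.
  have /andP[x0 x1] := torus_coord_itv x i.
  have Nx0 : 0 <= N.+1%:R * torus_coord x i by rewrite mulr_ge0.
  (* Coordinates are below 1, so the truncation is below N+1 and [inord] leaves it unchanged. *)
  rewrite ffunE inordK; first exact: truncn_itv.
  by rewrite truncn_lt_nat// gtr_pMr.
apply: (@measurable_fun_cvg _ _ _ _ (fun N x => f (corner N (cell N x)))) =>
  [N|x _].
  rewrite (_ : (fun x => _) = fun x => \sum_(g : {ffun 'I_d -> 'I_N.+1})
      f (corner N g) * \1_[set x | cell N x = g] x); last first.
    apply/funext => x; rewrite (bigD1 (cell N x))//= indicE mem_set// mulr1.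
    rewrite big1 ?addr0// => g /eqP gx; rewrite indicE memNset ?mulr0//=.
    by move=> xg; exact: gx.
  apply: (proj1 (bmeas_sum _ _)) => g; apply/bmeasZ/bmeas_indic.
  rewrite (_ : mkset _ = \bigcap_(i in [set: 'I_d])
      ((fun x => torus_coord x i) @^-1`
        `[(g i)%:R / N.+1%:R, (g i).+1%:R / N.+1%:R[%classic)); last first.
    have N0 : 0 < N.+1%:R :> R by [].
    apply/seteqP; split=> [x /= <- i _|x /= xg].
      have /andP[c1 c2] := cellP N x i.
      by rewrite /= in_itv/= ler_pdivrMr// ltr_pdivlMr// mulrC c1 c2.
    apply/ffunP => i; rewrite ffunE; apply: val_inj => /=.
    have := xg i I; rewrite /= in_itv/= ler_pdivrMr// ltr_pdivlMr// mulrC =>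
      /andP[c1 c2].
    by rewrite (@truncn_def _ _ (g i)) ?inordK// c1.
  apply: fin_bigcap_measurable => // i _.
  rewrite -[X in measurable X]setTI.
  by apply: measurable_torus_coord => //; exact: measurable_itv.
apply/cvgrPdist_lt => e e0; have [r r0 rP] := cf x e e0.
near=> N; apply: rP.
rewrite -{1}(to_torusK x); apply: le_lt_trans (torus_dist_to_torus _ _) _.
apply: (@le_lt_trans _ _ (\sum_(i < d) N.+1%:R^-1)).
  apply: ler_sum => i _; have /andP[c1 c2] := cellP N x i.
  have N0 : 0 < N.+1%:R :> R by [].
  rewrite ger0_norm ?subr_ge0 ?ler_pdivrMr 1?mulrC// lerBlDr.
  by rewrite -[X in X + _]mulr1 -mulrDr addrC natr1 ler_pdivlMl// ltW.
rewrite sumr_const card_ord -[_ *+ d]mulr_natl ltr_pdivrMr// mulrC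
  -ltr_pdivrMr//.
apply: (@lt_trans _ _ N%:R); last by rewrite ltr_nat.
by near: N; exact: nbhs_infty_gtr.
Unshelve. all: by end_near. Qed.

End torus_metric.

(** * Uniform continuity and boundedness by compactness *)

Section torus_compactness.
Context (R : realType) (d : nat).
Variable f : torus R d -> R.
Hypothesis cf : torus_rcontinuous f.

(** Compactness is borrowed from the closed unit cube, which this map sends onto the torus, gluing
    opposite faces. *)
Let of_row (v : 'rV[R]_d) : torus R d := to_torus (v ord0).
Let cube := [set v : 'rV[R]_d | forall i, `[0, 1]%classic (v ord0 i)].

Let compact_cube : compact cube.
Proof. by apply: (@rV_compact R d (fun=> `[0, 1]%classic)) => i;
  exact: segment_compact. Qed.

Let of_row_cube x : exists2 v, cube v & of_row v = x.
Proof.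
exists (\row_i torus_coord x i).
  move=> i; rewrite mxE /= in_itv/=.
  by have /andP[-> /ltW] := torus_coord_itv x i.
rewrite /of_row -[RHS]to_torusK; congr to_torus.
by apply/funext => i; rewrite mxE.
Qed.

Let near_of_row (v : 'rV[R]_d) (r : R) : 0 < r ->
  \forall w \near v, torus_dist (of_row v) (of_row w) < r.
Proof.
(* Dividing by d+1 makes the sum of d terms strictly less than [r] and covers d = 0. *)
move=> r0; pose e := r / d.+1%:R.
have e0 : 0 < e by rewrite divr_gt0.
near=> w.
apply: le_lt_trans (torus_dist_to_torus _ _) _.
apply: (@le_lt_trans _ _ (\sum_(i < d) e)).
  apply: ler_sum => i _; apply/ltW.
  have : ball v e w by near: w; exact: nbhsx_ballx.
  by move=> [_ /(_ ord0 i)].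
rewrite sumr_const card_ord -[_ *+ d]mulr_natl /e mulrCA gtr_pMr//.
by rewrite ltr_pdivrMr// mul1r ltr_nat.
Unshelve. all: by end_near. Qed.

(** Heine-Cantor. [P] compares with every [y] of the torus, so pairs that are close across the
    wrap-around are included. *)
Lemma torus_rcontinuous_unif (e : R) : 0 < e -> exists2 r : R, 0 < r &
  forall x y, torus_dist x y < r -> `|f x - f y| < e.
Proof.
move=> e0.
have /compact_near_coveringP ccov := compact_cube.
pose P (r : R) (w : 'rV[R]_d) := forall y,
  torus_dist (of_row w) y < r -> `|f (of_row w) - f y| < e.
have Ploc v : cube v -> \forall w \near v & r \near (0 : R)^'+, P r w.
  move=> _; have [r r0 rP] := cf (of_row v) (divr_gt0 e0 (ltr0n R 2)).
  (* Half of [r] is for moving the centre to [w], half for reaching [y]. *)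
  have r20 : 0 < r / 2 by lra.
  exists ([set w | torus_dist (of_row v) (of_row w) < r / 2], [set s | s < r /
    2]).
    by split=> /=; [exact: near_of_row|exact: nbhs_right_lt].
  move=> [w s] /= [vw sr] y wy.
  have H1 : `|f (of_row v) - f (of_row w)| < e / 2 by apply: rP; lra.
  have H2 : `|f (of_row v) - f y| < e / 2.
    by apply: rP; have := torus_dist_triangle (of_row w) (of_row v) y; lra.
  rewrite (_ : _ - _ = (f (of_row v) - f y) - (f (of_row v) - f (of_row w)));
    last by ring.
  by apply: le_lt_trans (ler_normB _ _) _; lra.
have near0 := ccov R (0 : R)^'+ P _ Ploc.
near (0 : R)^'+ => r.
exists r => // x y; have [v cv <-] := of_row_cube x.
by move: v cv y; near: r; exact: near0.
Unshelve. all: by end_near. Qed.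

Lemma torus_rcontinuous_bounded : exists M : R, forall x, `|f x| <= M.
Proof.
have /compact_near_coveringP ccov := compact_cube.
pose P (M : R) (w : 'rV[R]_d) := `|f (of_row w)| <= M.
have Ploc v : cube v -> \forall w \near v & M \near +oo, P M w.
  move=> _; have [r r0 rP] := cf (of_row v) ltr01.
  exists ([set w | torus_dist (of_row v) (of_row w) < r],
          [set M | `|f (of_row v)| + 1 <= M]).
    by split=> /=; [exact: near_of_row|exact: nbhs_pinfty_ge].
  move=> [w M] /= [/rP vw vM]; apply: le_trans vM.
  rewrite -lerBlDl; apply: le_trans (ltW vw).
  by rewrite distrC lerB_dist.
have near0 := ccov R +oo P _ Ploc.
near (pinfty_nbhs R) => M.
exists M => x; have [v cv <-] := of_row_cube x.
by move: v cv; near: M; exact: near0.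
Unshelve. all: by end_near. Qed.

End torus_compactness.

Lemma torus_rcontinuous_bmeas (R : realType) d (f : torus R d -> R) :
  torus_rcontinuous f -> bmeas f.
Proof.
move=> cf; split; first exact: measurable_torus_rcontinuous.
exact: torus_rcontinuous_bounded.
Qed.

(** * Fubini for bounded functions, measures and charges *)

Section Rintegral_fubini.
Context (R : realType) d1 d2 (T1 : measurableType d1) (T2 : measurableType d2).
Variables (m1 : {finite_measure set T1 -> \bar R})
          (m2 : {finite_measure set T2 -> \bar R}).
Variable h : T1 * T2 -> R.
Hypothesis bh : bmeas h.

Lemma bmeas_pair1 x : bmeas (fun y => h (x, y)).
Proof. exact: (bmeas_comp (@measurable_pair1 _ _ _ _ x) bh). Qed.

Lemma bmeas_pair2 y : bmeas (fun x => h (x, y)).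
Proof. exact: (bmeas_comp (@measurable_pair2 _ _ _ _ y) bh). Qed.

Lemma bmeas_integrable_prod : (m1 \x m2)%E.-integrable [set: T1 * T2]
  (EFin \o h).
Proof.
have [mh [M hM]] := bh.
apply: measurable_bounded_integrable => //.
  have m12T : (m1 \x m2)%E [set: T1 * T2] = (m1 [set: T1] * m2 [set: T2])%E.
    by rewrite -product_measure1E// setXTT.
  rewrite /= m12T lte_mul_pinfty//.
    by rewrite ge0_fin_numE// fin_num_fun_lty.
  exact: fin_num_fun_lty.
exists M; split; first exact: num_real.
by move=> N MN y _ /=; rewrite (le_trans (hM _))// ltW.
Qed.

Lemma Rintegral_prod :
  \int[(m1 \x m2)%E]_z h z = \int[m1]_x \int[m2]_y h (x, y).
Proof.
rewrite /Rintegral -(integral12_prod_meas1 bmeas_integrable_prod); congr fine.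
apply: eq_integral => x _; rewrite /fubini_F RintegralE_bmeas//.
exact: bmeas_pair1.
Qed.

Lemma Rintegral_fubini : \int[m1]_x \int[m2]_y h (x, y) =
  \int[m2]_y \int[m1]_x h (x, y).
Proof.
rewrite -Rintegral_prod /Rintegral -(integral21_prod_meas1
  bmeas_integrable_prod); congr fine.
apply: eq_integral => y _; rewrite /fubini_G RintegralE_bmeas//.
exact: bmeas_pair2.
Qed.

Lemma bmeas_Rintegral : bmeas (fun x => \int[m2]_y h (x, y)).
Proof.
split.
  have /measurable_int := integrable_fubini_F bmeas_integrable_prod.
  rewrite (_ : fubini_F _ _ = EFin \o (fun x => \int[m2]_y h (x, y))).
    by move/measurable_EFinP.
  by apply/funext => x; rewrite /fubini_F/= -RintegralE_bmeas//;
    exact: bmeas_pair1.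
have [_ [M hM]] := bh.
exists (M * fine (m2 setT)) => x; apply: normr_Rintegral_le => //.
exact: bmeas_pair1.
Qed.

End Rintegral_fubini.

Section charge_fubini.
Context (R : realType) d1 d2 (T1 : measurableType d1) (T2 : measurableType d2).
Variables (m : {finite_measure set T1 -> \bar R}).
Variable nu : {charge set T2 -> \bar R}.
Variable h : T1 * T2 -> R.
Hypothesis bh : bmeas h.

Lemma bmeas_charge_integral : bmeas (fun x => charge_integral nu (fun y => h
  (x, y))).
Proof. by apply: bmeasB; exact: bmeas_Rintegral. Qed.

Lemma charge_integral_fubini :
  \int[m]_x charge_integral nu (fun y => h (x, y)) =
  charge_integral nu (fun y => \int[m]_x h (x, y)).
Proof.
rewrite /charge_integral RintegralB//; last 2 first.
- exact/bmeas_integrable/bmeas_Rintegral.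
- exact/bmeas_integrable/bmeas_Rintegral.
by rewrite !Rintegral_fubini.
Qed.

End charge_fubini.

Section torus_product.
Variable R : realType.

Lemma bmeas_torus_prod d (g : 'I_d -> circle R -> R) :
  (forall i, bmeas (g i)) -> bmeas (fun x : torus R d => \prod_(i < d) g i
    (tnth x i)).
Proof.
move=> bg; apply: bmeas_prod => i.
exact: (bmeas_comp (measurable_tnth i) (bg i)).
Qed.

(** Induction along the recursive construction of [torus_lebesgue]; in dimension 0 the Dirac mass at
    the empty tuple gives the empty product. *)
Lemma Rintegral_torus_prod d (g : 'I_d -> circle R -> R) :
  (forall i, bmeas (g i)) ->
  \int[torus_lebesgue R d]_x \prod_(i < d) g i (tnth x i) =
  \prod_(i < d) \int[@circle_lebesgue R]_u g i u.
Proof.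
elim: d g => [|d ih] g bg.
  rewrite big_ord0 /= /Rintegral integral_dirac//=.
    by rewrite indicT mul1r big_ord0.
  by apply/measurable_EFinP; exact: (proj1 (bmeas_torus_prod bg)).
pose h (z : circle R * torus R d) := g ord0 z.1 * \prod_(i < d) g (lift ord0 i)
  (tnth z.2 i).
have bh2 : bmeas (fun v : torus R d => \prod_(i < d) g (lift ord0 i) (tnth v
  i)).
  by apply: (@bmeas_torus_prod d (fun i => g (lift ord0 i))) => i; exact: bg.
have bh : bmeas h.
  apply: bmeasM.
    exact: (bmeas_comp measurable_fst (bg ord0)).
  exact: (bmeas_comp measurable_snd bh2).
transitivity (\int[(@circle_lebesgue R \x torus_lebesgue R d)%E]_z h z).
  rewrite /Rintegral /= integral_pushforward//=.
  - congr fine; apply: eq_integral => -[u v] _ /=.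
    rewrite big_ord_recl /h/= tnth0; congr (_ * _)%:E.
    by apply: eq_bigr => i _; rewrite tnthS.
  - by apply/measurable_EFinP; exact: (proj1 (bmeas_torus_prod bg)).
  - have := (bmeas_integrable_prod (@circle_lebesgue R) (torus_lebesgue R d)
      (bmeas_comp (@measurable_torus_cons R d) (bmeas_torus_prod bg))); exact.
rewrite Rintegral_prod// big_ord_recl -(ih (fun i => g (lift ord0 i)));
  last by move=> i; exact: bg.
rewrite -RintegralZr//; last exact: bmeas_integrable.
apply: eq_Rintegral => u _; rewrite /h/= RintegralZl//; exact: bmeas_integrable.
Qed.

End torus_product.

(** * Fejer means on the torus *)

Section torus_fejer_kernel.
Context (R : realType) (d : nat).
Implicit Types (x y : torus R d) (n : nat) (f : torus R d -> R).

Lemma fejerR_periodic n (t : R) : fejerR n (t - 1) = fejerR n t.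
Proof.
rewrite /fejerR; congr (_ + 2 * _); apply: eq_bigr => k _; congr (_ * _).
by rewrite mulrBr mulr1 cosB cos_2pin sin_2pin mulr1 mulr0 addr0.
Qed.

Lemma continuous_fejerR n : continuous (@fejerR R n).
Proof.
move=> t; rewrite /fejerR; apply: cvgD; first exact: cvg_cst.
apply: cvgM; first exact: cvg_cst.
apply: cvg_big => [|k _]; first exact: add_continuous.
apply: cvgM; first exact: cvg_cst.
exact: continuous_cosM.
Qed.

Lemma bmeas_shift (h : R -> R) (y : R) : @bmeas R _ (measurableTypeR R) h ->
  @bmeas R _ (measurableTypeR R) (fun t => h (t - y)).
Proof.
apply: (@bmeas_comp R _ _ (measurableTypeR R) (measurableTypeR R)).
exact: measurable_funB.
Qed.

Lemma circle_Rintegral_shift (h : R -> R) (y : R) :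
  @bmeas R _ (measurableTypeR R) h -> continuous h ->
  (forall t, h (t - 1) = h t) -> 0 <= y < 1 ->
  \int[@circle_lebesgue R]_u h (circle_val u - y) =
  \int[lebesgue_measure]_(t in `[0, 1]) h t.
Proof.
move=> bh ch h1 y01.
rewrite (@circle_Rintegral R (fun t => h (t - y))); last exact: bmeas_shift.
exact: Rintegral_periodic_shift.
Qed.

Definition torus_fejer n x y : R :=
  \prod_(i < d) fejerR n (torus_coord x i - torus_coord y i).

Lemma fejerE n x y :
  fejer n (fun i => torus_coord x i - torus_coord y i) = ((torus_fejer n x
    y)%:C)%C.
Proof.
by rewrite /fejer /torus_fejer rmorph_prod; apply: eq_bigr => i _;
  exact: fejer1E.
Qed.

Lemma torus_fejer_ge0 n x y : 0 <= torus_fejer n x y.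
Proof. by apply: prodr_ge0 => i _; exact: fejerR_ge0. Qed.

Let measurable_coord_diff i : measurable_fun [set: torus R d * torus R d]
  (fun z => torus_coord z.1 i - torus_coord z.2 i : measurableTypeR R).
Proof.
have mc := @measurable_torus_coord R d i.
apply: measurable_funB; first exact: (measurableT_comp mc measurable_fst).
exact: (measurableT_comp mc measurable_snd).
Qed.

Lemma bmeas_torus_fejer n :
  bmeas (fun z : torus R d * torus R d => torus_fejer n z.1 z.2).
Proof.
apply: bmeas_prod => i.
exact: (bmeas_comp (measurable_coord_diff i) (bmeas_fejerR R n)).
Qed.

Lemma bmeas_torus_fejerl n y : bmeas (fun x => torus_fejer n x y).
Proof. exact: (bmeas_pair2 (bmeas_torus_fejer n)). Qed.

Lemma Rintegral_torus_fejer n y :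
  \int[torus_lebesgue R d]_x torus_fejer n x y = 1.
Proof.
pose g (i : 'I_d) (u : circle R) := fejerR n (circle_val u - torus_coord y i).
rewrite (@Rintegral_torus_prod R d g) => [|i]; last first.
  exact: (bmeas_comp (@measurable_circle_val R) (bmeas_shift _ (bmeas_fejerR R
    n))).
rewrite big1// => i _; rewrite circle_Rintegral_shift ?torus_coord_itv//.
- exact: Rintegral_fejer.
- exact: bmeas_fejerR.
- exact: continuous_fejerR.
- exact: fejerR_periodic.
Qed.

Lemma bmeas_torus_dist y : bmeas (torus_dist y).
Proof. exact/torus_rcontinuous_bmeas/torus_lip1_continuous/torus_lip1_dist. Qed.

(** The distance is a sum over coordinates and the kernel a product, so in the i-th summand every
    factor but the i-th integrates to 1. The d summands are equal, whence the factor d. *)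
Lemma Rintegral_dist_fejer n y :
  \int[torus_lebesgue R d]_x (torus_dist y x * torus_fejer n x y) =
  d%:R * fejer_moment R n.
Proof.
pose g (i j : 'I_d) (t : R) := (if j == i then nid t else 1) * fejerR n t.
have bg i j : @bmeas R _ (measurableTypeR R) (g i j).
  apply: bmeasM; last exact: bmeas_fejerR.
  by case: (j == i); [exact: bmeas_nid|exact: bmeas_cst].
pose G i j (u : circle R) := g i j (circle_val u - torus_coord y j).
have bG i j : bmeas (G i j).
  exact: (bmeas_comp (@measurable_circle_val R) (bmeas_shift _ (bg i j))).
rewrite (_ : (fun x => _) = fun x => \sum_(i < d) \prod_(j < d) G i j (tnth x
  j)); last first.
  apply/funext => x; rewrite torus_dist_sym torus_distE mulr_suml;
    apply: eq_bigr => i _.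
  rewrite /G /g big_split/=; congr (_ * _).
  by rewrite (bigD1 i)//= eqxx big1 ?mulr1// => j /negbTE ->.
rewrite (bounded_functional_sum (bounded_functional_Rintegral (torus_lebesgue R
  d))); last first.
  by move=> i; exact: bmeas_torus_prod.
rewrite (eq_bigr (fun=> fejer_moment R n));
  first by rewrite sumr_const card_ord mulr_natl.
move=> i _; rewrite Rintegral_torus_prod//.
have Gint j : \int[@circle_lebesgue R]_u G i j u =
    \int[lebesgue_measure]_(t in `[0, 1]) g i j t.
  rewrite circle_Rintegral_shift ?torus_coord_itv//.
  - move=> t; apply: cvgM; last exact: continuous_fejerR.
    by case: (j == i); [exact: continuous_nid|exact: cvg_cst].
  - move=> t; rewrite /g fejerR_periodic; case: (j == i) => //; congr (_ * _).
    by rewrite -[in RHS](subrK 1 t) (nid_int (t - 1) 1).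
rewrite (bigD1 i)//= Gint big1 ?mulr1.
  by rewrite -Rintegral_nid_fejer /g eqxx.
move=> j ji; rewrite Gint /g (negbTE ji).
by under eq_Rintegral do rewrite mul1r; exact: Rintegral_fejer.
Qed.

(** This is F_n * f, the kernel being even; the arguments stand in the order in which Fubini
    produces them from [fejer_conv]. *)
Definition fejer_smooth f n y : R :=
  \int[torus_lebesgue R d]_x (f x * torus_fejer n x y).

Let bmeas_smooth_integrand f n : bmeas f ->
  bmeas (fun z : torus R d * torus R d => f z.1 * torus_fejer n z.1 z.2).
Proof.
by move=> bf; apply: bmeasM (bmeas_torus_fejer n);
  exact: (bmeas_comp measurable_fst bf).
Qed.

Lemma bmeas_fejer_smooth f n : bmeas f -> bmeas (fejer_smooth f n).
Proof.
move=> bf.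
have bs := bmeas_comp (@measurable_swap _ _ (torus R d) (torus R d))
  (bmeas_smooth_integrand n bf).
exact: (bmeas_Rintegral (torus_lebesgue R d) (torus_lebesgue R d) bs).
Qed.

Lemma charge_integral_smooth (nu : {charge set (torus R d) -> \bar R}) f n :
  bmeas f ->
  \int[torus_lebesgue R d]_x (f x * charge_integral nu (torus_fejer n x)) =
  charge_integral nu (fejer_smooth f n).
Proof.
move=> bf; rewrite -(charge_integral_fubini _ _ (bmeas_smooth_integrand n bf)).
have [_ CZ _] := bounded_functional_charge nu.
apply: eq_Rintegral => x _; rewrite /= CZ//.
exact: (bmeas_pair1 (bmeas_torus_fejer n)).
Qed.

(** The affine bound serves twice: a = 0, b = 1 for 1-Lipschitz [f], and small [a] with large [b]
    for merely continuous [f]. Since the kernel is a probability density in [x], integrating the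
    bound leaves [a] unchanged. *)
Lemma normr_fejer_smoothB_le f n y (a b : R) : bmeas f ->
  (forall x, `|f x - f y| <= a + b * torus_dist y x) ->
  `|fejer_smooth f n y - f y| <= a + b * (d%:R * fejer_moment R n).
Proof.
move=> bf fab; have bK := bmeas_torus_fejerl n y.
have bL := bounded_functional_Rintegral (torus_lebesgue R d);
  have [LD LZ _] := bL.
have bfy := @bmeas_cst R _ (torus R d) (f y).
have -> : fejer_smooth f n y - f y =
    \int[torus_lebesgue R d]_x ((f x - f y) * torus_fejer n x y).
  rewrite -[X in _ - X]mulr1 -(Rintegral_torus_fejer n y) -LZ//.
  rewrite -(bounded_functionalB bL); [|exact: bmeasM..].
  by congr Rintegral; apply/funext => x; rewrite mulrBl.
have bI : bmeas (fun x => (f x - f y) * torus_fejer n x y).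
  by apply: bmeasM => //; exact: bmeasB.
apply: (le_trans (le_normr_Rintegral measurableT (bmeas_integrable
  (torus_lebesgue R d) bI))).
have bd := bmeas_torus_dist y.
have -> : a + b * (d%:R * fejer_moment R n) = \int[torus_lebesgue R d]_x
    (a * torus_fejer n x y + b * (torus_dist y x * torus_fejer n x y)).
  rewrite LD; [|exact: bmeasZ|by apply/bmeasZ/bmeasM].
  by rewrite !LZ ?Rintegral_torus_fejer ?Rintegral_dist_fejer ?mulr1//;
    exact: bmeasM.
apply: le_Rintegral => //.
- apply: bmeas_integrable; case: bI => mI [M IM]; split.
    exact: measurableT_comp.
  by exists M => x; rewrite normr_id.
- by apply/bmeas_integrable/bmeasD; apply/bmeasZ => //; exact: bmeasM.
move=> x _; rewrite normrM (ger0_norm (torus_fejer_ge0 _ _ _)) mulrA -mulrDl.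
by rewrite ler_wpM2r// torus_fejer_ge0.
Qed.

End torus_fejer_kernel.

(** * Weak convergence, the W1 bound and its sharpness *)

Section fejer_convergence.
Context (R : realType) (d : nat).
Implicit Types (x y : torus R d) (n : nat) (f : torus R d -> R).
Implicit Types (mu : cmeasure (torus R d) R).

Lemma fejer_convE n mu x : fejer_conv n mu x =
  (charge_integral (cmeas_re mu) (torus_fejer n x)
   +i* charge_integral (cmeas_im mu) (torus_fejer n x))%C.
Proof.
rewrite /fejer_conv -cintegral_real; congr cintegral.
by apply/funext => y; exact: fejerE.
Qed.

Let bmeas_charge_fejer (nu : {charge set (torus R d) -> \bar R}) n :
  bmeas (fun x => charge_integral nu (torus_fejer n x)).
Proof. exact: (bmeas_charge_integral (torus_lebesgue R d) nu (bmeas_torus_fejer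
  R d n)). Qed.

(** Turns the test integral for W1 into one against [mu] alone, where [cmod_cintegral_le]
    applies. *)
Lemma cintegral_fejer_measureB n mu f : bmeas f ->
  cintegral (csub (fejer_measure n mu) mu) (fun x => (f x)%:C)%C =
  cintegral mu (fun y => (fejer_smooth f n y - f y)%:C)%C.
Proof.
move=> bf; rewrite !cintegral_real /=.
have bs := bmeas_fejer_smooth n bf.
have Re_conv : (fun x => complex.Re (fejer_conv n mu x)) =
    (fun x => charge_integral (cmeas_re mu) (torus_fejer n x)).
  by apply/funext => x; rewrite fejer_convE.
have Im_conv : (fun x => complex.Im (fejer_conv n mu x)) =
    (fun x => charge_integral (cmeas_im mu) (torus_fejer n x)).
  by apply/funext => x; rewrite fejer_convE.
rewrite !charge_integral_cadd// !charge_integral_copp//.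
rewrite !charge_integral_induced//; [|by rewrite ?Re_conv ?Im_conv;
  exact: bmeas_charge_fejer..].
rewrite !(bounded_functionalB (bounded_functional_charge _))//.
rewrite -!charge_integral_smooth//.
congr (_ +i* _)%C; congr (_ - _); apply: eq_Rintegral => x _.
  by congr (_ * _); exact: (congr1 (@^~ x) Re_conv).
by congr (_ * _); exact: (congr1 (@^~ x) Im_conv).
Qed.

Lemma W1_fejer_le n mu : (W1 (fejer_measure n mu) mu <=
  (d%:R * fejer_moment R n)%:E * cmeas_variation mu)%E.
Proof.
apply: ge_ereal_sup => _ [f lf <-].
have bf := torus_rcontinuous_bmeas (torus_lip1_continuous lf).
rewrite cintegral_fejer_measureB//; apply: cmod_cintegral_le.
  by apply: bmeasB => //; exact: bmeas_fejer_smooth.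
move=> y; rewrite -[leRHS]mul1r -[leRHS]add0r.
apply: normr_fejer_smoothB_le => // x.
by rewrite add0r mul1r torus_dist_sym lf.
Qed.

Lemma fejer_moment_cvg0 : fejer_moment R n @[n --> \oo] --> (0 : R).
Proof.
apply/cvgrPdist_lt => e e0; near=> n.
rewrite sub0r normrN ger0_norm ?fejer_moment_ge0//.
have e20 : 0 < e / 2 by lra.
apply: le_lt_trans (fejer_moment_le n e20) _.
suff H : (e / 2)^-1 / n.+1%:R < e / 2 by rewrite [ltRHS]splitr ltrD2l.
rewrite ltr_pdivrMr// -ltr_pdivrMl//.
apply: (@lt_trans _ _ n%:R); last by rewrite ltr_nat.
by near: n; exact: nbhs_infty_gtr.
Unshelve. all: by end_near. Qed.

Lemma fejer_smooth_unif f (e : R) : torus_rcontinuous f -> 0 < e ->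
  \forall n \near \oo, forall y, `|fejer_smooth f n y - f y| <= e.
Proof.
move=> cf e0; have bf := torus_rcontinuous_bmeas cf.
have [M fM] := torus_rcontinuous_bounded cf.
have e20 : 0 < e / 2 by lra.
have [r r0 rP] := torus_rcontinuous_unif cf e20.
have M0 : 0 <= M by exact: le_trans (fM point).
(* At distance at least [r] the trivial bound 2M is at most b times the distance; closer points are
   covered by e/2. *)
pose b := 2 * M / r.
have b0 : 0 <= b by rewrite divr_ge0 ?mulr_ge0// ltW.
have : (b * (d%:R * fejer_moment R n)) @[n --> \oo] --> (b * (d%:R * 0) : R).
  by apply: cvgM; [exact: cvg_cst|apply: cvgM;
    [exact: cvg_cst|exact: fejer_moment_cvg0]].
rewrite !mulr0 => /cvgrPdist_lt /(_ _ e20) He.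
near=> n => y.
apply: (@le_trans _ _ (e / 2 + b * (d%:R * fejer_moment R n))).
  apply: normr_fejer_smoothB_le => // x.
  have [xy|xy] := ltP (torus_dist x y) r.
    rewrite (le_trans (ltW (rP _ _ xy)))// lerDl.
    by rewrite mulr_ge0 ?torus_dist_ge0.
  apply: (@le_trans _ _ (b * torus_dist y x)); last by rewrite lerDr ltW.
  apply: le_trans (ler_normB _ _) _; apply: (@le_trans _ _ (b * r)).
    by rewrite /b divfK ?gt_eqF//; have := fM x; have := fM y; lra.
  by rewrite ler_wpM2l// torus_dist_sym.
have : `|0 - b * (d%:R * fejer_moment R n)| < e / 2 by near: n; exact: He.
by rewrite sub0r normrN => /ltr_normlW; lra.
Unshelve. all: by end_near. Qed.

Lemma charge_integral_smooth_cvg (nu : {charge set (torus R d) -> \bar R}) f :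
  torus_rcontinuous f ->
  charge_integral nu (fejer_smooth f n) @[n --> \oo] --> charge_integral nu f.
Proof.
move=> cf; have bf := torus_rcontinuous_bmeas cf.
have bL := bounded_functional_charge nu; have [_ _ [K LK]] := bL.
apply/cvgrPdist_lt => e e0.
(* [K] may be zero or negative, hence |K| + 1. *)
pose c := e / (`|K| + 1).
have K0 : 0 < `|K| + 1 by rewrite ltr_wpDl.
have c0 : 0 < c by rewrite divr_gt0.
have := fejer_smooth_unif cf c0; apply: filterS => n nc.
rewrite distrC -(bounded_functionalB bL)//; last exact: bmeas_fejer_smooth.
apply: le_lt_trans (LK _ c _ nc) _.
  by apply: bmeasB => //; exact: bmeas_fejer_smooth.
rewrite /c mulrA ltr_pdivrMr// mulrC ltr_pM2l//.
by rewrite (le_lt_trans (ler_norm _))// ltrDl.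
Qed.

Lemma cmod_le (a b : R) : cmod (a +i* b)%C <= `|a| + `|b|.
Proof.
rewrite cmodE -[leRHS]ger0_norm ?addr_ge0// -sqrtr_sqr ler_wsqrtr//.
by rewrite sqrrD !real_normK ?num_real// lerD2r lerDl mulrn_wge0// mulr_ge0.
Qed.

Lemma ge_cmod_Re (z : R[i]) : `|complex.Re z| <= cmod z.
Proof.
by case: z => a b; rewrite cmodE -sqrtr_sqr ler_wsqrtr//= lerDl sqr_ge0.
Qed.

Lemma ge_cmod_Im (z : R[i]) : `|complex.Im z| <= cmod z.
Proof.
by case: z => a b; rewrite cmodE -sqrtr_sqr ler_wsqrtr//= lerDr sqr_ge0.
Qed.

Lemma cvg_complex (u v : nat -> R) (a b : R) :
  u n @[n --> \oo] --> a -> v n @[n --> \oo] --> b ->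
  (fun n => (u n +i* v n)%C : R[i]^o) @ \oo --> ((a +i* b)%C : R[i]^o).
Proof.
move=> /cvgrPdist_lt ua /cvgrPdist_lt vb.
apply/cvgrPdist_lt => -[e e'].
(* A positive element of [R[i]] is real, so the radius reduces to a real number. *)
rewrite ltcE/= => /andP[/eqP -> e0].
have e20 : 0 < e / 2 by lra.
have {}ua := ua _ e20; have {}vb := vb _ e20.
near=> n.
have Hu : `|a - u n| < e / 2 by near: n.
have Hv : `|b - v n| < e / 2 by near: n.
rewrite normc_def ltcE /= eqxx/=.
by apply: le_lt_trans (cmod_le (a - u n) (b - v n)) _; lra.
Unshelve. all: by end_near. Qed.

Lemma torus_continuous_Re (f : torus R d -> R[i]) :
  torus_continuous f -> torus_rcontinuous (fun x => complex.Re (f x)).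
Proof.
move=> cf x e e0; have [r r0 rP] := cf x e e0; exists r => // y /rP.
by apply: le_lt_trans; rewrite -raddfB ge_cmod_Re.
Qed.

Lemma torus_continuous_Im (f : torus R d -> R[i]) :
  torus_continuous f -> torus_rcontinuous (fun x => complex.Im (f x)).
Proof.
move=> cf x e e0; have [r r0 rP] := cf x e e0; exists r => // y /rP.
by apply: le_lt_trans; rewrite -raddfB ge_cmod_Im.
Qed.

Lemma fejer_weak_cvg mu : density_weak_cvg (fun n => fejer_conv n mu) mu.
Proof.
move=> f cf; have cr := torus_continuous_Re cf;
  have ci := torus_continuous_Im cf.
have br := torus_rcontinuous_bmeas cr; have bi := torus_rcontinuous_bmeas ci.
set re := cmeas_re mu; set im := cmeas_im mu.
set fr := fun x => complex.Re (f x); set fi := fun x => complex.Im (f x).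
have -> : (fun n => cLintegral (torus_lebesgue R d)
      (fun x => f x * fejer_conv n mu x) : R[i]^o) =
    (fun n => ((charge_integral re (fejer_smooth fr n) - charge_integral im
      (fejer_smooth fi n))
     +i* (charge_integral re (fejer_smooth fi n) + charge_integral im
         (fejer_smooth fr n)))%C).
  apply/funext => n; rewrite -!charge_integral_smooth//.
  have bL := bounded_functional_Rintegral (torus_lebesgue R d);
    have [LD _ _] := bL.
  have bM (nu : {charge set (torus R d) -> \bar R}) (g : torus R d -> R) :
    bmeas g ->
      bmeas (fun x => g x * charge_integral nu (torus_fejer n x)).
    by move=> bg; apply: bmeasM.
  rewrite -(bounded_functionalB bL); [|exact: bM..].
  rewrite -LD; [|exact: bM..].
  congr (_ +i* _)%C; congr Rintegral; apply/funext => x;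
    rewrite fejer_convE /fr /fi.
    by case: (f x).
  by case: (f x) => p q /=; rewrite addrC.
by apply: cvg_complex; [apply: cvgB|apply: cvgD];
  exact: charge_integral_smooth_cvg.
Qed.

Lemma charge_integral_dirac (nu : {charge set (torus R d) -> \bar R}) (x0 :
  torus R d) f :
  (forall A, measurable A -> nu A = dirac x0 A) -> bmeas f ->
  charge_integral nu f = f x0.
Proof.
move=> nuE; apply: (@charge_integralP _ _ _ _ (fun f => f x0)).
  by split=> //; exists 1 => g M _ /(_ x0); rewrite mul1r.
by move=> A mA; rewrite nuE.
Qed.

Definition torus_dirac x : cmeasure (torus R d) R :=
  CMeasure (charge_of_finite_measure (dirac x)) (@czero _ (torus R d) R).

Lemma torus_dirac_nonneg x A : measurable A -> 0 <= cmeas (torus_dirac x) A.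
Proof.
move=> mA; rewrite /cmeas lecE/= eqxx/= /charge_of_finite_measure.
by rewrite indicE ler0n.
Qed.

Lemma torus_dirac_normalized x : normalized_cmeasure (torus_dirac x).
Proof.
have x1 : cmeas (torus_dirac x) setT = 1.
  by rewrite /cmeas /= /charge_of_finite_measure /= indicT.
split => //; rewrite cmeas_variation_nonneg ?ltry// => A.
exact: torus_dirac_nonneg.
Qed.

Lemma W1_fejer_dirac_ge n x :
  ((d%:R * fejer_moment R n)%:E <= W1 (fejer_measure n (torus_dirac x))
    (torus_dirac x))%E.
Proof.
apply: ereal_sup_ge; exists (cmod (cintegral (csub (fejer_measure n
  (torus_dirac x))
    (torus_dirac x)) (fun y => (torus_dist x y)%:C)%C))%:E.
  by exists (torus_dist x) => //; exact: torus_lip1_dist.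
have bd := bmeas_torus_dist x.
have bs := bmeas_fejer_smooth n bd.
rewrite cintegral_fejer_measureB// lee_fin cintegral_real.
apply: le_trans (ge_cmod_Re _); rewrite /=.
rewrite (@charge_integral_dirac _ x)//; last exact: bmeasB.
rewrite /fejer_smooth Rintegral_dist_fejer torus_distE big1; last first.
  by move=> i _; rewrite subrr nid_lower ?lexx//= invr_ge0.
by rewrite subr0 ler_norm.
Qed.

End fejer_convergence.

Theorem theorem2p5 (R : realType) (d : nat) (d_gt0 : (0 < d)%N) :
  (forall mu : cmeasure (torus R d) R, normalized_cmeasure mu ->
     density_weak_cvg (fun n => fejer_conv n mu) mu /\
     (forall n : nat, (0 < n)%N ->
        (W1 (fejer_measure n mu) mu <=
         (d%:R / pi ^+ 2 * ((ln n.+1%:R + 3) / n%:R))%:E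
         * cmeas_variation mu)%E)) /\
  (forall mu : cmeasure (torus R d) R, nonneg_normalized_cmeasure mu ->
     cmeas_variation mu = 1%E) /\
  (forall n : nat, (0 < n)%N ->
     ((d%:R / pi ^+ 2 * (ln n.+2%:R / n.+1%:R + n.+3%:R^-1))%:E <=
      ereal_sup [set W1 (fejer_measure n mu) mu |
        mu in @normalized_cmeasure R d])%E).
Proof.
split; [|split].
- move=> mu [_ mu1]; split=> [|n n0]; first exact: fejer_weak_cvg.
  apply: (le_trans (W1_fejer_le n mu)); apply: lee_wpmul2r.
    (* The total variation is nonnegative by comparison with the partition into the whole space and
       the empty set. *)
    apply: le_trans (cmeas_variation_ge2 mu measurableT measurable0 _ _).
    + by rewrite lee_fin addr_ge0 ?cmod_ge0.
    + by rewrite setU0.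
    + by rewrite setI0.
  by rewrite lee_fin -mulrA ler_wpM2l// fejer_moment_ub.
- by move=> mu [[_ mu1] mu0]; exact: cmeas_variation_nonneg.
- move=> n n0; pose x0 : torus R d := to_torus (fun=> 0).
  apply: ereal_sup_ge; exists (W1 (fejer_measure n (torus_dirac x0)) (torus_dirac x0)).
    by exists (torus_dirac x0) => //; exact: torus_dirac_normalized.
  apply: le_trans (W1_fejer_dirac_ge n x0).
  by rewrite lee_fin -mulrA ler_wpM2l// fejer_moment_lb.
Qed.
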